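(* For every integer base $b\geq 2$ there are infinitely many cube-free base-$b$ palindromes. More generally, for any integer $k\geq 3$, let \[ \mathcal{P}_b^*(x)=\{n\leq x:\ \gcd(n,b^3-b)=1\ \text{and}\ n=\overleftarrow{n}\} \] and \[ p_{k,b}(x)=\#\{n\in\mathcal{P}_b^*(x):\ n\ \text{is } k\text{th power-free}\}. \] Then there exists an effectively computable constant $c_2(b)>0$ such that, as $x\to\infty$, \[ p_{k,b}(x)=\frac{|\mathcal{P}_b^*(x)|}{\zeta(k)}\prod_{p\mid b^3-b}\left(1-\frac{1}{p^k}\right)^{-1}\left(1+O_{b}\left(e^{-c_2(b)\sqrt{\log x}}\right)\right), \] where the product is over primes $p$ dividing $b^3-b$.
   Context: Fix an integer base $b\geq 2$. For a positive integer $n$ with $N$ base-$b$ digits, $n=\sum_{0\leq i<N}n_ib^i$ with $0\le n_i<b$ and $n_{N-1}\neq 0$, its digital reverse is $\overleftarrow{n}=\sum_{0\leq i<N}n_ib^{N-1-i}$. A palindrome is a positive integer $n$ with $b\nmid n$ and $n=\overleftarrow{n}$. An integer is $k$th power-free if it is not divisible by $d^k$ for any integer $d>1$; cube-free means $3$rd power-free. $\zeta$ is the Riemann zeta-function; the implied constant in $O_b$ depends only on $b$. *)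

(* Defs.v *)
From HB Require Import structures.
From mathcomp Require Import all_boot all_order all_algebra.
From mathcomp Require Import finmap.
From mathcomp Require Import all_classical all_reals all_analysis.

Set Implicit Arguments.
Unset Strict Implicit.
Unset Printing Implicit Defensive.

Import Order.TTheory GRing.Theory Num.Theory.
Import numFieldNormedType.Exports.

Local Open Scope classical_set_scope.

Definition num_digits (b n : nat) : nat :=
  if n == 0 then 0 else (trunc_log b n).+1.

Definition digit (b n i : nat) : nat := (n %/ b ^ i) %% b.

Definition digit_rev (b n : nat) : nat :=
  \sum_(0 <= i < num_digits b n) digit b n i * b ^ (num_digits b n - 1 - i).

Definition palindrome (b n : nat) : Prop :=
  [/\ 0 < n, ~~ (b %| n) & n = digit_rev b n].

Definition power_free (k n : nat) : Prop :=
  forall d, 1 < d -> ~~ (d ^ k %| n).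

(* Elements are positive; b does not divide them, since b | b^3 - b. *)
Definition Pstar (R : realType) (b : nat) (x : R) : set nat :=
  [set n | [/\ 0 < n, (n%:R <= x)%R, coprime n (b ^ 3 - b)
             & n = digit_rev b n]].

(* [fset_set] is the finite set underlying a finite classical set, and [Pstar]
   is finite, being bounded by x. *)
Definition Pstar_card (R : realType) (b : nat) (x : R) : nat :=
  #|` fset_set (Pstar b x)|.

Definition p_count (R : realType) (k b : nat) (x : R) : nat :=
  #|` fset_set (Pstar b x `&` [set n | power_free k n])|.

(* The terms of [riemannR s] are 1 / (n + 1)^s; only used for s > 1. *)
Definition zeta (R : realType) (s : R) : R := limn (series (riemannR s)).

(* The total recursive functions (Kleene): minimisation is only applied to
   functions having a zero, so that every function of the class is total. *)
Inductive recursive : forall n : nat, (n.-tuple nat -> nat) -> Prop :=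
| rec_zero n : recursive (fun _ : n.-tuple nat => 0)
| rec_succ : recursive (fun v : 1.-tuple nat => (thead v).+1)
| rec_proj n (i : 'I_n) : recursive (fun v : n.-tuple nat => tnth v i)
| rec_comp m n (f : m.-tuple nat -> nat) (g : 'I_m -> n.-tuple nat -> nat) :
    recursive f -> (forall i, recursive (g i)) ->
    recursive (fun v : n.-tuple nat => f [tuple g i v | i < m])
| rec_prim n (f : n.-tuple nat -> nat) (g : n.+2.-tuple nat -> nat) :
    recursive f -> recursive g ->
    recursive (fun v : n.+1.-tuple nat =>
      let w : n.-tuple nat := [tuple of behead v] in
      iteri (thead v) (fun i r => g [tuple of i :: r :: w]) (f w))
| rec_mu n (f : n.+1.-tuple nat -> nat) (h : n.-tuple nat -> nat) :
    recursive f ->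
    (forall v, f [tuple of h v :: v] = 0) ->
    (forall v i, i < h v -> f [tuple of i :: v] <> 0) ->
    recursive h.

(* An algorithm that, given b and m, returns an approximation a(b, m) / (m + 1)
   of c b within 1 / (m + 1). As the numerators are natural numbers, this is
   the notion of computability for nonnegative c. *)
Definition effectively_computable (R : realType) (c : nat -> R) : Prop :=
  exists2 a : 2.-tuple nat -> nat, recursive a &
    forall b m : nat, (`|c b - (a [tuple b; m])%:R / m.+1%:R| <= m.+1%:R^-1)%R.

(* Main.v *)
(* A palindrome with an even number of digits is divisible by b + 1, so every
   palindrome counted here has 2M + 1 digits and is a sum of a_i w_i over its
   upper half a_0, ..., a_M (a_0 being the central digit), with w_0 = b^M and
   w_i = b^(M+i) + b^(M-i).  For q coprime to b^3 - b, equidistribution of the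
   multiples of q among them is a bound on products of geometric sums in
   z_i = theta^(w_i), where theta^(b^2-1) is a q-th root of unity other than 1.
   As b w_(i+1) - w_i = b^(M+i) (b^2 - 1), if z_i and z_(i+1) are both close to 1
   then so is g^(b^(M+i)), g = theta^(b^2-1); but g^(b^j) drifts away from 1 within
   O(log q) steps, so each window of O(log q) indices contributes a factor
   1 - 1/K.  Hence the relative error for the modulus q is exp(-c M / log q).

   Detecting kth power-free numbers with the Moebius function, put
   M ~ (D s)^2 with D depending on b only.  Moduli d^k with d <= 4^s and
   d^k <= 2^(12 s) are handled by equidistribution with error 8^-s each.  All other
   moduli q use that the central digits of a multiple of q are determined by
   the outer ones, which leaves O(b^M q^(-1/2)) multiples of q; this is
   summable over d > 4^s since k >= 3.  The total error b^M 2^-s is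
   b^M exp(-c sqrt(log x)), and b^M is the order of the number of palindromes. *)
Require Import Defs.
From HB Require Import structures.
From mathcomp Require Import all_boot all_order all_algebra.
From mathcomp Require Import algC cyclotomic zify ring lra finmap.
From mathcomp Require Import all_classical all_reals all_analysis.

Set Implicit Arguments.
Unset Strict Implicit.
Unset Printing Implicit Defensive.

Import Order.TTheory GRing.Theory Num.Theory.

(** * Palindromes and their upper halves *)

Section Digits.
Variable b : nat.
Hypothesis b_gt1 : 1 < b.

Let b_gt0 : 0 < b. Proof. exact: ltnW. Qed.
Let bX_gt0 i : 0 < b ^ i. Proof. by rewrite expn_gt0 b_gt0. Qed.

Lemma digit_lt n i : digit b n i < b.
Proof. by rewrite ltn_mod. Qed.

Lemma digits_sum_lt (c : nat -> nat) N : (forall i, c i < b) ->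
  \sum_(i < N) c i * b ^ i < b ^ N.
Proof.
move=> c_lt; elim: N => [|N IH]; first by rewrite big_ord0.
rewrite big_ord_recr /= expnS; apply: (@leq_trans ((c N).+1 * b ^ N)).
  by rewrite mulSn ltn_add2r.
by rewrite leq_mul2r c_lt orbT.
Qed.

Lemma expand_digits n N : n < b ^ N -> n = \sum_(i < N) digit b n i * b ^ i.
Proof.
elim: N n => [|N IH] n lt_n; first by move: lt_n; rewrite expn0 big_ord0; case: n.
have lt_q : n %/ b < b ^ N by rewrite ltn_divLR // -expnSr.
rewrite big_ord_recl expn0 muln1 {1}(divn_eq n b) addnC; congr (_ + _).
  by rewrite /digit expn0 divn1.
rewrite {1}(IH _ lt_q) big_distrl /=; apply: eq_bigr => i _.
by rewrite /digit /bump /= add1n expnS divnMA -mulnA [b ^ i * b]mulnC.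
Qed.

Lemma digit_digits_sum (c : nat -> nat) N i : (forall j, c j < b) -> i < N ->
  digit b (\sum_(j < N) c j * b ^ j) i = c i.
Proof.
move=> c_lt lt_i; have -> : N = (i + (N - i.+1).+1) by lia.
rewrite big_split_ord /= big_ord_recl /= addn0 /digit.
set lo := \sum_(_ < i) _; set hi := \sum_(_ < _) _.
have [r ->] : exists r, hi = r * b * b ^ i.
  exists (\sum_(j < N - i.+1) c (i + j.+1) * b ^ j).
  rewrite /hi !big_distrl /=; apply: eq_bigr => j _.
  by rewrite /bump /= add1n expnD expnS; lia.
rewrite -mulnDl addnC divnMDl // divn_small ?digits_sum_lt // addn0.
by rewrite addnC modnMDl modn_small.
Qed.

Lemma digit_small n i : n < b ^ i -> digit b n i = 0.
Proof. by move=> lt_n; rewrite /digit divn_small // mod0n. Qed.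

Lemma digit_addlow h l J i : l < b ^ J ->
  digit b (h * b ^ J + l) i = if i < J then digit b l i else digit b (h * b ^ J) i.
Proof.
move=> lt_l; rewrite /digit; case: ltnP => [lt_i | le_J].
  have -> : J = i + (J - i.+1).+1 by lia.
  by rewrite expnD [b ^ i * _]mulnC mulnA divnMDl // expnSr mulnA modnMDl.
have -> : i = J + (i - J) by lia.
by rewrite expnD !divnMA divnMDl // (divn_small lt_l) addn0 mulnK.
Qed.

Lemma digit_mulX_low h J i : i < J -> digit b (h * b ^ J) i = 0.
Proof.
move=> lt_i; have := @digit_addlow h 0 J i (bX_gt0 J).
by rewrite addn0 lt_i => ->; rewrite /digit div0n mod0n.
Qed.

(* Digit [i] of the upper half [A] sits at distance [i] from the centre, so that
   fixing the high digits of [A] fixes the outer digits of [pal M A]. *)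
Definition pal_weight (M i : nat) := if i == 0 then b ^ M else b ^ (M + i) + b ^ (M - i).

Definition dot_digits (w : nat -> nat) J n := \sum_(i < J) digit b n i * w i.

(** For [b^M <= A < b^(M+1)] this is the palindrome with [2M + 1] digits whose upper [M + 1] digits
    are those of [A]. *)
Definition pal M A := dot_digits (pal_weight M) M.+1 A.

Lemma dot_digits_addlow w M J h l : J <= M -> l < b ^ J ->
  dot_digits w M (h * b ^ J + l) = dot_digits w M (h * b ^ J) + dot_digits w J l.
Proof.
move=> leJ lt_l; have -> : M = J + (M - J) by lia.
rewrite /dot_digits !big_split_ord /=.
rewrite [X in _ = X + _ + _]big1 ?add0n => [|i _]; last by rewrite digit_mulX_low.
rewrite addnC; congr (_ + _); apply: eq_bigr => i _; rewrite digit_addlow ?ltn_ord //.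
by rewrite ltnNge leq_addr.
Qed.

Lemma dot_digits_top w J a l : a < b -> l < b ^ J ->
  dot_digits w J.+1 (a * b ^ J + l) = dot_digits w J l + a * w J.
Proof.
move=> lt_a lt_l; rewrite dot_digits_addlow // addnC; congr (_ + _).
rewrite /dot_digits big_ord_recr /= big1 => [|i _]; last by rewrite digit_mulX_low.
by rewrite add0n /digit mulnK // modn_small.
Qed.

Lemma pal_add M J h l : J <= M.+1 -> l < b ^ J ->
  pal M (h * b ^ J + l) = pal M (h * b ^ J) + dot_digits (pal_weight M) J l.
Proof. exact: dot_digits_addlow. Qed.

(** Subtraction is truncated, so this is [|i - M|], the distance of position [i] from the centre. *)
Definition mirror M i := (i - M) + (M - i).

Lemma pal_digits M A :
  pal M A = \sum_(i < M.*2.+1) digit b A (mirror M i) * b ^ i.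
Proof.
have -> : M.*2.+1 = M + M.+1 by lia.
rewrite big_split_ord /= [\sum_(i < M) _](reindex_inj rev_ord_inj) /=.
rewrite [X in _ = _ + X]big_ord_recl /pal /dot_digits big_ord_recl /=.
rewrite /pal_weight eqxx addn0 /mirror subnn addn0 addnCA; congr (_ + _).
rewrite -big_split /=; apply: eq_bigr => i _.
have -> : M - i.+1 - M + (M - (M - i.+1)) = bump 0 i by have := ltn_ord i; rewrite /bump; lia.
have -> : M + bump 0 i - M + (M - (M + bump 0 i)) = bump 0 i by lia.
by rewrite mulnDr addnC.
Qed.

(** Positions [M] to [2M] carry the digits of [A], and the positions below contribute less than
    [b^M]. Recovering [A] in this way makes [pal] injective. *)
Lemma pal_divX M A : A < b ^ M.+1 -> pal M A %/ b ^ M = A.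
Proof.
move=> lt_A; rewrite pal_digits.
have -> : M.*2.+1 = M + M.+1 by lia.
rewrite big_split_ord /=.
set lo := \sum_(_ < M) _.
have -> : \sum_(i < M.+1) digit b A (mirror M (M + i)) * b ^ (M + i) = A * b ^ M.
  rewrite {2}(expand_digits lt_A) big_distrl /=; apply: eq_bigr => i _.
  rewrite expnD [b ^ M * _]mulnC mulnA; congr (digit _ _ _ * _ * _).
  by rewrite /mirror; lia.
rewrite addnC divnMDl // divn_small ?addn0 //.
by apply: (digits_sum_lt (c := fun i => digit b A (mirror M i))) => i; exact: digit_lt.
Qed.

Lemma pal_bounds M A : b ^ M <= A < b ^ M.+1 -> b ^ M.*2 <= pal M A < b ^ M.*2.+1.
Proof.
case/andP=> leA ltA; apply/andP; split.
  rewrite -addnn expnD -leq_divRL // pal_divX //.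
rewrite pal_digits.
by apply: (digits_sum_lt (c := fun i => digit b A (mirror M i))) => i; exact: digit_lt.
Qed.

Lemma num_digitsE n N : b ^ N <= n < b ^ N.+1 -> num_digits b n = N.+1.
Proof.
move=> bn; have n_gt0 : 0 < n by apply: leq_trans (bX_gt0 N) _; case/andP: bn.
by rewrite /num_digits eqn0Ngt n_gt0 /= (trunc_log_eq b_gt1 bn).
Qed.

Lemma num_digits_bounds n : 0 < n ->
  exists2 N, num_digits b n = N.+1 & b ^ N <= n < b ^ N.+1.
Proof.
move=> n_gt0; exists (trunc_log b n); first by rewrite /num_digits eqn0Ngt n_gt0.
exact: trunc_log_bounds.
Qed.

Lemma digit_revE n N : num_digits b n = N.+1 ->
  digit_rev b n = \sum_(i < N.+1) digit b n (N - i) * b ^ i.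
Proof.
move=> nd; rewrite /digit_rev nd big_mkord (reindex_inj rev_ord_inj) /=.
by apply: eq_bigr => i _; rewrite !subSS subn0 subKn // -ltnS.
Qed.

Lemma digit_pal M A i : A < b ^ M.+1 -> i < M.*2.+1 ->
  digit b (pal M A) i = digit b A (mirror M i).
Proof.
move=> lt_A lt_i; rewrite pal_digits.
by rewrite (digit_digits_sum (c := fun i => digit b A (mirror M i))) // => j; exact: digit_lt.
Qed.

Lemma pal_digit_rev M A : b ^ M <= A < b ^ M.+1 -> digit_rev b (pal M A) = pal M A.
Proof.
move=> bA; have /andP[_ ltA] := bA.
rewrite (digit_revE (num_digitsE (pal_bounds bA))) [RHS]pal_digits.
apply: eq_bigr => i _; rewrite digit_pal //; last by lia.
by congr (digit _ _ _ * _); rewrite /mirror; have := ltn_ord i; lia.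
Qed.

Lemma digit_rev_sym n N i : num_digits b n = N.+1 -> n = digit_rev b n -> i <= N ->
  digit b n i = digit b n (N - i).
Proof.
move=> nd nE lei; rewrite {1}nE (digit_revE nd).
by rewrite (digit_digits_sum (c := fun i => digit b n (N - i))) // => j; exact: digit_lt.
Qed.

(** Holds because [b] is [-1] modulo [b + 1]. *)
Lemma dvdn_succ_odd_exp k : odd k -> b.+1 %| 1 + b ^ k.
Proof.
move=> oddk; rewrite -[k]odd_double_half oddk [true + _]add1n.
elim: k./2 => [|m IH]; first by rewrite expn1 add1n.
have -> : 1 + b ^ m.+1.*2.+1 = b.+1 * (b.-1 * b ^ m.*2.+1) + (1 + b ^ m.*2.+1).
  rewrite doubleS 2!expnS; move: (b ^ _) => z.
  by case: (b) b_gt1 => // c _ /=; nia.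
by rewrite dvdn_add // dvdn_mulr.
Qed.

(** The equal digits at positions [i] and [N - i] contribute a multiple of [1 + b^(N - 2i)], and
    [N - 2i] is odd. As there are [N + 1] digits, odd [N] means even length. *)
Lemma even_length_dvd n N : num_digits b n = N.+1 -> odd N -> n = digit_rev b n ->
  b.+1 %| n.
Proof.
move=> nd oddN nE.
have n_gt0 : 0 < n by move: nd; rewrite /num_digits; case: n {nE}.
have [N' nd' /andP[_ ltn']] := num_digits_bounds n_gt0.
have eN : N' = N by move: nd'; rewrite nd; case.
rewrite {}eN in ltn'.
rewrite (expand_digits ltn').
have -> : N.+1 = N.+1./2 + N.+1./2 by have := odd_double_half N; lia.
rewrite big_split_ord /= [X in _ + X](reindex_inj rev_ord_inj) /= -big_split /=.
apply: dvdn_sum => i _.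
set h := N./2.+1 in i *; have hE : N = h.*2.-1 by have := odd_double_half N; rewrite /h; lia.
have lti := ltn_ord i.
rewrite (digit_rev_sym nd nE) /=; last by rewrite /h in lti *; lia.
have -> : uphalf N + (uphalf N - i.+1) = N - i by rewrite /h in lti *; lia.
rewrite -mulnDr dvdn_mull //.
have -> : N - i = i + (N - i.*2) by rewrite /h in lti *; lia.
rewrite expnD -{1}[b ^ i]muln1 -mulnDr dvdn_mull //.
have : odd (N - i.*2) by rewrite oddB ?odd_double ?oddN //; rewrite /h in lti *; lia.
exact: dvdn_succ_odd_exp.
Qed.

(** Converse of [pal_digit_rev]; with [pal_inj] it parametrises the palindromes of odd length by
    their upper halves. *)
Lemma odd_length_pal n M : num_digits b n = M.*2.+1 -> n = digit_rev b n ->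
  b ^ M <= n %/ b ^ M < b ^ M.+1 /\ n = pal M (n %/ b ^ M).
Proof.
move=> nd nE.
have n_gt0 : 0 < n by move: nd; rewrite /num_digits; case: n {nE}.
have [N' nd' /andP[len ltn']] := num_digits_bounds n_gt0.
have eN : N' = M.*2 by move: nd'; rewrite nd; case.
rewrite {}eN in len ltn'.
split.
  rewrite leq_divRL // ltn_divLR // -!expnD addnn len /=.
  by have -> : M.+1 + M = M.*2.+1 by lia.
rewrite pal_digits {1}(expand_digits ltn'); apply: eq_bigr => i _.
congr (_ * _); rewrite {2}/digit -divnMA -expnD -/(digit b n (M + mirror M i)).
have lti := ltn_ord i.
case: (leqP M i) => cmp; first by congr digit; rewrite /mirror; lia.
rewrite (digit_rev_sym nd nE); last by lia.
by congr digit; rewrite /mirror; lia.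
Qed.

Lemma pal_inj M M' A A' : b ^ M <= A < b ^ M.+1 -> b ^ M' <= A' < b ^ M'.+1 ->
  pal M A = pal M' A' -> M = M' /\ A = A'.
Proof.
move=> bA bA' eqp.
have := num_digitsE (pal_bounds bA); rewrite eqp (num_digitsE (pal_bounds bA')) => -[] e.
have eM : M = M' by lia.
split=> //; case/andP: bA => _ /pal_divX <-; rewrite eqp eM.
by rewrite pal_divX //; case/andP: bA'.
Qed.

End Digits.

(** * Exponential sums over digits *)

Lemma big_ord_mul (T : Type) (idx : T) (op : Monoid.law idx) m n (F : nat -> T) :
  \big[op/idx]_(i < m * n) F i =
  \big[op/idx]_(h < m) \big[op/idx]_(l < n) F (h * n + l).
Proof.
elim: m => [|m IH]; first by rewrite mul0n !big_ord0.
by rewrite mulSnr big_split_ord big_ord_recr /= IH.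
Qed.

Local Open Scope ring_scope.

(** * Distances to 1 and geometric sums on the unit circle *)

Section UnitCircle.
Variable C : numClosedFieldType.
Implicit Types g z : C.

Lemma sum_ord_const n (x : C) : \sum_(i < n) x = n%:R * x.
Proof. by rewrite sumr_const card_ord mulr_natl. Qed.

Lemma norm_subX1 z n : `|z| = 1 -> `|1 - z ^+ n| <= n%:R * `|1 - z|.
Proof.
move=> z1; elim: n => [|n IH]; first by rewrite expr0 subrr normr0 mul0r.
have -> : 1 - z ^+ n.+1 = (1 - z ^+ n) + z ^+ n * (1 - z) by rewrite exprS; ring.
apply: le_trans (ler_normD _ _) _; rewrite normrM normrX z1 expr1n mul1r.
by rewrite -natr1 mulrDl mul1r lerD2r.
Qed.

Lemma norm_geom_deficit z n (s : C) : `|z| = 1 -> `|1 - z| <= s ->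
  `|n%:R - \sum_(j < n) z ^+ j| <= n%:R * (n.-1%:R * s).
Proof.
move=> z1 zs.
have -> : n%:R - \sum_(j < n) z ^+ j = \sum_(j < n) (1 - z ^+ j).
  by rewrite sumrB sumr_const card_ord.
apply: le_trans (ler_norm_sum _ _ _) _.
rewrite -sum_ord_const; apply: ler_sum => j _; apply: le_trans (norm_subX1 _ z1) _.
apply: le_trans (ler_wpM2l _ zs) _ => //.
apply: ler_wpM2r; first exact: le_trans zs.
by rewrite ler_nat; have := ltn_ord j; lia.
Qed.

Lemma root1_norm q g : (0 < q)%N -> g ^+ q = 1 -> `|g| = 1.
Proof. by move=> q0 gq; apply/eqP; rewrite -(pexpr_eq1 q0) // -normrX gq normr1. Qed.

(** The full geometric sum of [g] vanishes, so its deficit is [q] itself, while [norm_geom_deficit]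
    bounds that deficit by [q (q - 1) |1 - g|]. *)
Lemma root1_gap q g : (0 < q)%N -> g ^+ q = 1 -> g != 1 -> 1 <= q%:R * `|1 - g|.
Proof.
move=> q0 gq g1.
have ng := root1_norm q0 gq.
have sum0 : \sum_(j < q) g ^+ j = 0.
  apply/eqP; have /eqP := subrX1 g q; rewrite gq subrr eq_sym mulf_eq0.
  by rewrite subr_eq0 (negbTE g1).
have := norm_geom_deficit q ng (lexx _).
rewrite sum0 subr0 normr_nat -{1}[q%:R]mulr1 ler_pM2l ?ltr0n // => h.
by apply: le_trans h _; apply: ler_wpM2r => //; rewrite ler_nat leq_pred.
Qed.

(** In [1 - g^b = (1 - g) (1 + g + ... + g^(b-1))], closeness of [g] to 1 keeps the sum within
    [(b - 1) / 2] of [b], hence of modulus at least [(b + 1) / 2 >= 3/2]. *)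
Lemma gap_growth (b : nat) g : (1 < b)%N -> `|g| = 1 -> `|1 - g| <= (b.*2)%:R^-1 ->
  3%:R / 2%:R * `|1 - g| <= `|1 - g ^+ b|.
Proof.
move=> b1 g1 small.
have -> : 1 - g ^+ b = (1 - g) * \sum_(j < b) g ^+ j by rewrite -opprB subrX1 -mulNr opprB.
rewrite normrM mulrC ler_wpM2l //.
have h := norm_geom_deficit b g1 small.
set s := \sum_(j < b) _ in h *.
have : b%:R <= `|s| + b%:R * (b.-1%:R * (b.*2)%:R^-1) :> C.
  apply: le_trans (_ : `|s| + `|b%:R - s| <= _); last by rewrite lerD2l.
  by rewrite -{1}(normr_nat C b) -{1}(subrK s b%:R) [_ + s]addrC ler_normD.
have -> : b%:R * (b.-1%:R * (b.*2)%:R^-1) = b%:R - (b.+1%:R / 2%:R) :> C.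
  case: b b1 {small h s} => // b _ /=.
  rewrite -addnn natrD -!natr1; field.
  by rewrite natr1 -natrD pnatr_eq0.
rewrite addrCA lerDl subr_ge0; apply: le_trans.
by rewrite ler_pM2r ?invr_gt0 ?ltr0n // ler_nat.
Qed.

(** The distance to 1 starts at [1/q] or more and grows by a factor [3/2] per step while it is below
    [1 / (2b)]. As [(3/2)^L >= q], it cannot stay below for [L] steps. *)
Lemma exists_gap (b L q : nat) g : (1 < b)%N -> (0 < q)%N -> (q * 2 ^ L <= 3 ^ L)%N ->
  g ^+ q = 1 -> g != 1 ->
  exists2 l, (l <= L)%N & (b.*2)%:R^-1 <= `|1 - g ^+ (b ^ l)|.
Proof.
move=> b1 q0 qL gq g1.
have ng := root1_norm q0 gq.
have key n : (exists2 l, (l <= n)%N & (b.*2)%:R^-1 <= `|1 - g ^+ (b ^ l)|) \/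
    (3%:R / 2%:R) ^+ n * `|1 - g| <= `|1 - g ^+ (b ^ n)|.
  elim: n => [|n [[l ln hl]|IH]]; first by right; rewrite expr0 mul1r expn0 expr1.
    by left; exists l => //; lia.
  (* The order on [C] is partial; comparing the two quantities requires that both be real. *)
  have real1 : `|1 - g ^+ (b ^ n)| \is Num.real by apply: normr_real.
  have real2 : (b.*2)%:R^-1 \is @Num.real C by rewrite realV realn.
  case: (real_leP real1 real2) => hn; last by left; exists n => //; exact: ltW.
  right; have := gap_growth b1 _ hn; rewrite normrX ng expr1n -exprM -expnSr => /(_ erefl).
  apply: le_trans; rewrite exprS -mulrA ler_wpM2l // divr_ge0 ?ler0n //.
case: (key L) => // h; exists L => //.
apply: le_trans h; apply: (@le_trans _ _ 1).
  by rewrite invf_le1 ?ltr0n ?ler1n; lia.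
apply: le_trans (root1_gap q0 gq g1) _; apply: ler_wpM2r => //.
by rewrite expr_div_n ler_pdivlMr -?natrX ?ltr0n ?expn_gt0 // -natrM ler_nat.
Qed.

Lemma norm_geom_le (b : nat) z : `|z| = 1 -> `|\sum_(a < b) z ^+ a| <= b%:R.
Proof.
move=> z1; apply: le_trans (ler_norm_sum _ _ _) _.
rewrite -[b%:R]mulr1 -sum_ord_const; apply: ler_sum => i _.
by rewrite normrX z1 expr1n.
Qed.

(** The first two terms already cancel: [|1 + z|^2 + |1 - z|^2 = 4] gives
    [|1 + z|^2 <= 4 - e^2 <= (2 - e^2/4)^2]. The other [b - 2] terms are bounded by 1 each. *)
Lemma norm_geom_cancel (b : nat) z (e : C) : (1 < b)%N -> `|z| = 1 -> 0 <= e ->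
  e <= `|1 - z| -> `|\sum_(a < b) z ^+ a| <= b%:R - e ^+ 2 / 4%:R.
Proof.
move=> b1 z1 e0 ez.
have e2 : e <= 2%:R.
  by apply: le_trans ez _; apply: le_trans (ler_normB _ _) _; rewrite normr1 z1.
have par : `|1 + z| ^+ 2 + `|1 - z| ^+ 2 = 4%:R.
  have zz : z * z^* = 1 by rewrite -normCK z1 expr1n.
  rewrite !normCK rmorphD rmorphB rmorph1.
  have -> : (1 + z) * (1 + z^*) + (1 - z) * (1 - z^*) = 2%:R + 2%:R * (z * z^*) by ring.
  by rewrite zz; ring.
have h2 : `|1 + z| <= 2%:R - e ^+ 2 / 4%:R.
  have e4 : 0 <= 2%:R - e ^+ 2 / 4%:R.
    rewrite subr_ge0 ler_pdivrMr ?ltr0n // -natrM; apply: le_trans (_ : 2%:R ^+ 2 <= _).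
      by rewrite lerXn2r ?nnegrE ?ler0n.
    by rewrite -natrX ler_nat.
  rewrite -(@ler_pXn2r _ 2) ?nnegrE //.
  have -> : `|1 + z| ^+ 2 = 4%:R - `|1 - z| ^+ 2 by rewrite -par addrK.
  apply: le_trans (_ : 4%:R - e ^+ 2 <= _).
    by rewrite lerD2l lerN2 lerXn2r ?nnegrE // (le_trans e0 ez).
  have -> : (2%:R - e ^+ 2 / 4%:R) ^+ 2 = 4%:R - e ^+ 2 + (e ^+ 2 / 4%:R) ^+ 2 by field.
  by rewrite lerDl exprn_ge0 // divr_ge0 ?exprn_ge0 ?ler0n.
case: b b1 => [|[|b]] // _; rewrite 2!big_ord_recl expr0 expr1 addrA.
apply: le_trans (ler_normD _ _) _.
have -> : b.+2%:R - e ^+ 2 / 4%:R = (2%:R - e ^+ 2 / 4%:R) + b%:R :> C.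
  by rewrite -addn2 natrD; ring.
apply: lerD => //; apply: le_trans (ler_norm_sum _ _ _) _.
rewrite -[b%:R]mulr1 -sum_ord_const; apply: ler_sum => i _.
by rewrite normrX z1 expr1n.
Qed.

End UnitCircle.

(* Equals [b / (e ^ 2 / 4)] for the gap [e = 1 / (2 b (b + 1))]. *)
Definition decay_const (b : nat) := (16 * b ^ 3 * b.+1 ^ 2)%N.

Lemma decay_const_gt0 b : (0 < b)%N -> (0 < decay_const b)%N.
Proof. by move=> b0; rewrite /decay_const 2!muln_gt0 2!expn_gt0 b0. Qed.

(** A factor with cancellation is thus at most [b (1 - 1/K)]. Clearing the denominator [K] lets
    later bounds be stated over [nat]. *)
Lemma decay_constE (F : numFieldType) b : (0 < b)%N ->
  (decay_const b)%:R * (b%:R - (2 * b * b.+1)%:R^-1 ^+ 2 / 4%:R) =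
  b%:R * (decay_const b - 1)%:R :> F.
Proof.
move=> b0; rewrite natrB ?decay_const_gt0 // /decay_const.
rewrite [(16 * _ * _)%:R]natrM [(16 * _)%:R]natrM 2!natrX [(2 * b * _)%:R]natrM [(2 * b)%:R]natrM.
rewrite -[b.+1%:R]natr1; field.
by rewrite natr1 !pnatr_eq0 -!lt0n b0.
Qed.

(** * Decay of products of digit sums *)

Section DigitProducts.
Variables (C : numClosedFieldType) (b : nat).
Hypothesis b_gt1 : (1 < b)%N.
Variables (M q L : nat) (theta : C).
Hypothesis theta1 : `|theta| = 1.
Let B := (b ^ 2 - 1)%N.
Let g := theta ^+ B.
Hypotheses (q_gt0 : (0 < q)%N) (cop_bq : coprime b q) (Lq : (q * 2 ^ L <= 3 ^ L)%N).
Hypotheses (gq : g ^+ q = 1) (g_neq1 : g != 1).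
Let w := pal_weight b M.
Let z (i : nat) := theta ^+ w i.
Let e : C := (2 * b * b.+1)%:R^-1.
Let K := decay_const b.

Let z1 i : `|z i| = 1. Proof. by rewrite normrX theta1 expr1n. Qed.

(** As [b^n] is invertible modulo [q], [g] is a power of [g^(b^n)] and would be 1 with it. *)
Lemma root1_coprime_pow n : g ^+ (b ^ n) != 1.
Proof.
have cop : coprime q (b ^ n) by rewrite coprime_sym coprimeXl.
apply/eqP => h; move/eqP: g_neq1; apply.
have [u v huv _] := egcdnP (b ^ n) q_gt0.
have : g ^+ (u * q) = g ^+ (v * b ^ n) * g.
  by rewrite huv exprD; move/eqP: cop => ->; rewrite expr1.
by rewrite mulnC exprM gq expr1n mulnC exprM h expr1n mul1r.
Qed.

(** The lower summands [b * b^(M-i-1)] and [b^(M-i)] cancel. The central weight [b^M] has a single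
    summand, so the recurrence only starts at [i = 1]. *)
Lemma weight_rec i : (0 < i)%N -> (i < M)%N ->
  (b * w i.+1 = w i + b ^ (M + i) * B)%N.
Proof.
move=> i0 iM; rewrite /w /pal_weight /B /= eqn0Ngt i0 /=.
have -> : (M - i = (M - i.+1).+1)%N by lia.
rewrite addnS !expnS; have := b_gt1; move: (b ^ (M + i))%N (b ^ _)%N => x y.
by case: (b) => // c _; nia.
Qed.

(** Some [g^(b^(M+i))] with [i <= i0 + L] is at distance [1 / (2b)] or more from 1. Since it is the
    quotient of [z (i+1)^b] by [z i], one of [z i], [z (i+1)] is far from 1; hence a window of
    [L + 2] indices. *)
Lemma exists_decay i0 : (0 < i0)%N -> (i0 + L.+1 <= M)%N ->
  exists2 i, (i0 <= i < i0 + L.+2)%N & e <= `|1 - z i|.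
Proof.
move=> i0_gt0 le_M.
have hq : (g ^+ (b ^ (M + i0))) ^+ q = 1 by rewrite -exprM mulnC exprM gq expr1n.
have [l lL] := exists_gap b_gt1 q_gt0 Lq hq (root1_coprime_pow _).
rewrite -exprM -expnD -addnA; set i := (i0 + l)%N => hl.
have step : `|1 - g ^+ (b ^ (M + i))| <= `|1 - z i| + b%:R * `|1 - z i.+1|.
  have -> : `|1 - g ^+ (b ^ (M + i))| = `|z i - z i.+1 ^+ b|.
    have -> : z i.+1 ^+ b = z i * g ^+ (b ^ (M + i)).
      rewrite -[RHS]mulr1 /z -exprM [(w _ * b)%N]mulnC weight_rec; [|by rewrite /i; lia|by rewrite /i; lia].
      by rewrite mulr1 exprD /g -exprM [(B * _)%N]mulnC.
    by rewrite -{1}[z i]mulr1 -mulrBr normrM z1 mul1r.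
  have -> : z i - z i.+1 ^+ b = (1 - z i.+1 ^+ b) - (1 - z i) by ring.
  apply: le_trans (ler_normB _ _) _; rewrite addrC lerD2l.
  exact: norm_subX1.
have real1 j : `|1 - z j| \is Num.real by apply: normr_real.
have real2 : e \is Num.real by rewrite realV realn.
case: (real_leP real2 (real1 i)) => h1; first by exists i => //; rewrite /i; lia.
case: (real_leP real2 (real1 i.+1)) => h2; first by exists i.+1 => //; rewrite /i; lia.
have : (b.*2)%:R^-1 < e + b%:R * e.
  apply: le_lt_trans hl _; apply: le_lt_trans step _.
  by apply: ltrD => //; rewrite ltr_pM2l // ltr0n ltnW.
(* The value of [e] is chosen to make this an equality, which contradicts the strict inequality. *)
have -> : e + b%:R * e = (b.*2)%:R^-1.
  rewrite /e -mul2n !natrM -[b.+1%:R]natr1; field.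
  by rewrite natr1 !pnatr_eq0 -!lt0n ltnW.
by rewrite ltxx.
Qed.

Let phi (i : nat) := `|\sum_(a < b) z i ^+ a|.

Let phi_le i : phi i <= b%:R. Proof. exact: norm_geom_le. Qed.

(** One factor of the window gains [1 - 1/K] by [exists_decay]; the others are bounded trivially by
    [b]. *)
Lemma prod_phi_window i0 : (0 < i0)%N -> (i0 + L.+1 <= M)%N ->
  K%:R * \prod_(j < L.+2) phi (i0 + j) <= b%:R ^+ L.+2 * (K - 1)%:R.
Proof.
move=> i0_gt0 le_M; have [i /andP[ii1 ii2] hi] := exists_decay i0_gt0 le_M.
have lt_i : (i - i0 < L.+2)%N by lia.
rewrite (bigD1 (Ordinal lt_i)) //=.
have -> : (i0 + (i - i0) = i)%N by lia.
have -> : b%:R ^+ L.+2 = b%:R * \prod_(j < L.+2 | j != Ordinal lt_i) b%:R :> C.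
  transitivity (\prod_(j < L.+2) (b%:R : C)); first by rewrite prodr_const card_ord.
  by rewrite (bigD1 (Ordinal lt_i)).
rewrite mulrA [b%:R * _ * _]mulrAC; apply: ler_pM.
- by rewrite mulr_ge0 ?ler0n ?normr_ge0.
- by apply: prodr_ge0 => j _; exact: normr_ge0.
- have e0 : 0 <= e by rewrite invr_ge0 ler0n.
  apply: le_trans (ler_wpM2l _ (norm_geom_cancel b_gt1 (z1 i) e0 hi)) _; first exact: ler0n.
  by rewrite decay_constE // ltnW.
- by apply: ler_prod => j _; rewrite normr_ge0 phi_le.
Qed.

(** [W] disjoint windows are laid out from index 1, the centre being outside [weight_rec]; all
    remaining factors are bounded by [b]. *)
Lemma prod_phi_le W J : (1 + W * L.+2 <= J)%N -> (J <= M.+1)%N ->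
  K%:R ^+ W * \prod_(i < J) phi i <= b%:R ^+ J * (K - 1)%:R ^+ W.
Proof.
move=> leJ leM.
have main V : (1 + V * L.+2 <= M.+1)%N -> K%:R ^+ V * \prod_(i < 1 + V * L.+2) phi i
    <= b%:R ^+ (1 + V * L.+2) * (K - 1)%:R ^+ V.
  elim: V => [|V IH] leV.
    by rewrite !expr0 mul1r mulr1 mul0n addn0 expr1 big_ord1.
  have -> : (1 + V.+1 * L.+2 = (1 + V * L.+2) + L.+2)%N by lia.
  rewrite big_split_ord /= 2!exprS exprD.
  set p1 := \prod_(_ < _ + _) _; set p2 := \prod_(_ < _) _.
  have -> : K%:R * K%:R ^+ V * (p1 * p2) = (K%:R ^+ V * p1) * (K%:R * p2) by ring.
  have -> : b%:R ^+ (1 + V * L.+2) * b%:R ^+ L.+2 * ((K - 1)%:R * (K - 1)%:R ^+ V) =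
     (b%:R ^+ (1 + V * L.+2) * (K - 1)%:R ^+ V) * (b%:R ^+ L.+2 * (K - 1)%:R) :> C by ring.
  apply: ler_pM.
  - by rewrite mulr_ge0 ?exprn_ge0 ?ler0n // prodr_ge0 // => i _; exact: normr_ge0.
  - by rewrite mulr_ge0 ?ler0n // prodr_ge0 // => i _; exact: normr_ge0.
  - by apply: IH; lia.
  - by apply: prod_phi_window; lia.
rewrite -(subnKC leJ) big_split_ord /= exprD.
set p1 := \prod_(_ < _ + _) _; set p2 := \prod_(_ < _) _.
have -> : K%:R ^+ W * (p1 * p2) = (K%:R ^+ W * p1) * p2 by ring.
have -> : b%:R ^+ (1 + W * L.+2) * b%:R ^+ (J - (1 + W * L.+2)) * (K - 1)%:R ^+ W =
  (b%:R ^+ (1 + W * L.+2) * (K - 1)%:R ^+ W) * b%:R ^+ (J - (1 + W * L.+2)) :> C by ring.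
apply: ler_pM.
- by rewrite mulr_ge0 ?exprn_ge0 ?ler0n // prodr_ge0 // => i _; exact: normr_ge0.
- by rewrite prodr_ge0 // => i _; exact: normr_ge0.
- by apply: main; lia.
- rewrite -[X in _ <= _ ^+ X]card_ord -prodr_const.
  by apply: ler_prod => j _; rewrite normr_ge0 phi_le.
Qed.

End DigitProducts.

(** The exponent is linear in the digits, and the digits of [A] range independently, so the sum
    factors. *)
Lemma sum_pow_dot_digits (R : comNzRingType) b (w : nat -> nat) (x : R) J : (1 < b)%N ->
  \sum_(A < b ^ J) x ^+ dot_digits b w J A = \prod_(i < J) \sum_(a < b) (x ^+ w i) ^+ a.
Proof.
move=> b1; elim: J => [|J IH].
  by rewrite expn0 big_ord0 big_ord1 /dot_digits big_ord0.
rewrite expnS (big_ord_mul _ b (b ^ J) (fun A => x ^+ dot_digits b w J.+1 A)) big_ord_recr /= -IH mulrC big_distrl /=.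
apply: eq_bigr => a _; rewrite big_distrr /=; apply: eq_bigr => l _.
by rewrite dot_digits_top ?ltn_ord // exprD mulrC -exprM mulnC.
Qed.

Lemma prim_root_sum (F : fieldType) q (eta : F) n : q.-primitive_root eta ->
  \sum_(a < q) (eta ^+ n) ^+ a = (q * (q %| n))%:R.
Proof.
move=> pr; rewrite (prim_order_dvd pr); case: eqP => [->|ne].
  rewrite muln1 (eq_bigr (fun=> 1)) => [|a _]; last by rewrite expr1n.
  by rewrite sumr_const card_ord.
rewrite muln0; apply/eqP; have /eqP := subrX1 (eta ^+ n) q.
rewrite -exprM mulnC exprM (prim_expr_order pr) expr1n subrr eq_sym mulf_eq0.
by rewrite subr_eq0; move/eqP/negbTE: ne => ->.
Qed.

Lemma dvdn_add_coprime B n t : (B %| n + t)%N -> coprime n B = coprime t B.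
Proof.
move=> dvd; rewrite /coprime; congr (_ == _); apply/eqP.
rewrite eqn_dvd !dvdn_gcd !dvdn_gcdr !andbT.
rewrite -(dvdn_addr _ (dvdn_gcdl n B)) -(dvdn_addl _ (dvdn_gcdl t B)).
by rewrite !(dvdn_trans _ dvd) ?dvdn_gcdr.
Qed.

(** Exactly one [t] satisfies [n = -t] modulo [B], and it is coprime to [B] exactly when [n] is.
    This turns coprimality into congruences, which additive characters detect. *)
Lemma sum_residue_coprime B n : (0 < B)%N ->
  (\sum_(t < B | coprime t B) (B %| n + t) = coprime n B)%N.
Proof.
move=> B0; have lt_t : ((B - n %% B) %% B < B)%N by rewrite ltn_mod.
have dvd : (B %| n + (B - n %% B) %% B)%N.
  rewrite /dvdn -modnDml modnDmr subnKC ?modnn // ltnW // ltn_mod //.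
rewrite big_mkcond (bigD1 (Ordinal lt_t)) //= dvd.
rewrite big1 ?addn0 => [|i ne_i]; first by rewrite (dvdn_add_coprime dvd); case: ifP.
case: ifP => // _; case: (boolP (B %| n + i)%N) => // dvdi.
case/eqP: ne_i; apply/val_inj => /=.
rewrite -[LHS](modn_small (ltn_ord i)); apply/eqP.
by rewrite -(eqn_modDl n) -[X in _ == X]modnDmr (eqP dvd).
Qed.

(** * Equidistribution within a block by Fourier analysis *)

Section BlockEquidistribution.
Variables (b M J q L W c : nat).
Hypothesis b_gt1 : (1 < b)%N.
Let B := (b ^ 2 - 1)%N.
Let K := decay_const b.
Let n A := (c + dot_digits b (pal_weight b M) J A)%N.
Hypotheses (q_gt0 : (0 < q)%N) (cop_bq : coprime b q) (cop_Bq : coprime B q).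
Hypotheses (Lq : (q * 2 ^ L <= 3 ^ L)%N) (WJ : (1 + W * L.+2 <= J)%N) (JM : (J <= M.+1)%N).

Let b_gt0 : (0 < b)%N. Proof. exact: ltnW. Qed.
Let B_gt0 : (0 < B)%N. Proof. by rewrite /B subn_gt0 -{1}(exp1n 2) ltn_sqr. Qed.

Lemma exp_sum_le (C : numClosedFieldType) (theta : C) : theta ^+ B != 1 ->
  (theta ^+ B) ^+ q = 1 ->
  K%:R ^+ W * `|\sum_(A < b ^ J) theta ^+ n A| <= (b ^ J * (K - 1) ^ W)%:R.
Proof.
move=> g1 gq.
have th1 : `|theta| = 1.
  by apply: (@root1_norm _ (B * q)%N); rewrite ?muln_gt0 ?B_gt0 // exprM.
under eq_bigr do rewrite /n exprD.
rewrite -big_distrr /= normrM normrX th1 expr1n mul1r sum_pow_dot_digits // normr_prod.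
by rewrite natrM !natrX; apply: (prod_phi_le b_gt1 th1 q_gt0 cop_bq Lq gq g1).
Qed.

(** Both divisibilities are detected by additive characters, of frequency [a] modulo [q] and [r]
    modulo [B]. The terms with [a = 0] form the main term; the other [(q - 1) B] are bounded by
    [exp_sum_le]. *)
Lemma residue_equidist t (C := algC) Nt Aqt :
  Nt = (\sum_(A < b ^ J) (B %| n A + t))%N ->
  Aqt = (\sum_(A < b ^ J) ((q %| n A) && (B %| n A + t)))%N ->
  K%:R ^+ W * `|(q * Aqt)%:R - Nt%:R| <= (q * b ^ J * (K - 1) ^ W)%:R :> C.
Proof.
move=> NtE AqtE.
have [eta pr_eta] := C_prim_root_exists q_gt0.
have [om pr_om] := C_prim_root_exists B_gt0.
pose S := \sum_(A < b ^ J) (\sum_(r < B) (om ^+ (n A + t)) ^+ r) *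
                           (\sum_(a < q) (eta ^+ n A) ^+ a).
pose G (a r : nat) := \sum_(A < b ^ J) (om ^+ r * eta ^+ a) ^+ n A.
have S_count : S = B%:R * (q * Aqt)%:R.
  rewrite AqtE -natrM mulnA big_distrr /= natr_sum; apply: eq_bigr => A _.
  rewrite !prim_root_sum // -natrM; congr _%:R.
  by case: (q %| _)%N; case: (B %| _)%N; rewrite ?muln0 ?muln1.
have S_fourier : S = \sum_(a < q) \sum_(r < B) om ^+ (t * r) * G a r.
  rewrite exchange_big /=.
  under [RHS]eq_bigr do under eq_bigr do rewrite /G big_distrr /=.
  under [RHS]eq_bigr do rewrite exchange_big /=.
  rewrite [RHS]exchange_big /=; apply: eq_bigr => A _.
  rewrite big_distrl /=; apply: eq_bigr => r _.
  rewrite big_distrr /=; apply: eq_bigr => a _.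
  rewrite exprMn -!exprM mulnDl exprD [(r * _)%N]mulnC [(a * _)%N]mulnC.
  by rewrite mulrA [om ^+ (t * r) * _]mulrC.
have q1 : q = q.-1.+1 by rewrite prednK.
(* Frequency [a = 0] carries no condition modulo [q] and returns [B] times the count [Nt]. *)
have S0 : \sum_(r < B) om ^+ (t * r) * G 0%N r = B%:R * Nt%:R.
  under eq_bigr do rewrite /G big_distrr /=.
  rewrite exchange_big /= -natrM NtE big_distrr /= natr_sum; apply: eq_bigr => A _.
  rewrite -(prim_root_sum _ pr_om); apply: eq_bigr => r _.
  by rewrite expr0 mulr1 -!exprM mulnDl exprD mulrC [(r * _)%N]mulnC.
have main : B%:R * ((q * Aqt)%:R - Nt%:R) =
    \sum_(a < q.-1) \sum_(r < B) om ^+ (t * r) * G a.+1 r.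
  rewrite mulrBr -S_count -S0 S_fourier.
  have -> : \sum_(a < q) \sum_(r < B) om ^+ (t * r) * G a r =
    \sum_(a < q.-1.+1) \sum_(r < B) om ^+ (t * r) * G a r by rewrite -q1.
  by rewrite big_ord_recl /= addrAC subrr add0r.
have B0 : 0 < B%:R :> C by rewrite ltr0n.
rewrite -(ler_pM2l B0) mulrCA -{1}(normr_nat C B) -normrM main.
have om1 : `|om| = 1 by apply: (root1_norm B_gt0); exact: prim_expr_order.
have term (a : 'I_q.-1) (r : 'I_B) :
    K%:R ^+ W * `|om ^+ (t * r) * G a.+1 r| <= (b ^ J * (K - 1) ^ W)%:R.
  rewrite normrM normrX om1 expr1n mul1r.
  (* The power [B] removes the character modulo [B]; as [B] is coprime to [q], the remaining root of
     unity is not 1. *)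
  have thB : (om ^+ r * eta ^+ a.+1) ^+ B = (eta ^+ a.+1) ^+ B.
    by rewrite exprMn [om ^+ r ^+ B]exprAC (prim_expr_order pr_om) expr1n mul1r.
  apply: exp_sum_le; rewrite thB -exprM.
    rewrite -(prim_order_dvd pr_eta) Gauss_dvdl; last by rewrite coprime_sym.
    by apply/negP => /dvdn_leq; have := ltn_ord a; lia.
  by rewrite -exprM mulnC exprM (prim_expr_order pr_eta) expr1n.
apply: le_trans (ler_wpM2l _ (ler_norm_sum _ _ _)) _; first by rewrite exprn_ge0 ?ler0n.
rewrite big_distrr /=.
apply: (@le_trans _ _ (\sum_(a < q.-1) \sum_(r < B) (b ^ J * (K - 1) ^ W)%:R)).
  apply: ler_sum => a _.
  apply: le_trans (ler_wpM2l _ (ler_norm_sum _ _ _)) _; first by rewrite exprn_ge0 ?ler0n.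
  by rewrite big_distrr /=; apply: ler_sum => r _; exact: term.
rewrite !sum_ord_const -!natrM ler_nat mulnCA leq_mul2l -mulnA leq_mul2r.
by rewrite leq_pred !orbT.
Qed.

(* The two inequalities together bound [|q A - N|] by [q B b ^ J (1 - 1 / K) ^ W]. *)
Lemma block_equidist :
  let N := (\sum_(A < b ^ J) coprime (n A) B)%N in
  let Aq := (\sum_(A < b ^ J) ((q %| n A) && coprime (n A) B))%N in
  let err := (B * (q * b ^ J * (K - 1) ^ W))%N in
  (K ^ W * (q * Aq) <= K ^ W * N + err)%N /\ (K ^ W * N <= K ^ W * (q * Aq) + err)%N.
Proof.
move=> N Aq err.
have key t : let Nt := (\sum_(A < b ^ J) (B %| n A + t))%N in
  let Aqt := (\sum_(A < b ^ J) ((q %| n A) && (B %| n A + t)))%N in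
  let er := (q * b ^ J * (K - 1) ^ W)%N in
  (K ^ W * (q * Aqt) <= K ^ W * Nt + er)%N /\ (K ^ W * Nt <= K ^ W * (q * Aqt) + er)%N.
  move=> Nt Aqt er; have := residue_equidist (t := t) erefl erefl.
  rewrite -/Nt -/Aqt -/er -natrX -{1}(normr_nat algC (K ^ W)) -normrM mulrBr -!natrM.
  rewrite real_ler_distl ?rpredB ?realn //.
  by rewrite lerBlDr -!natrD !ler_nat => /andP[-> ->].
have N_sum : N = (\sum_(t < B | coprime t B) \sum_(A < b ^ J) (B %| n A + t))%N.
  by rewrite exchange_big /=; apply: eq_bigr => A _; rewrite sum_residue_coprime.
have A_sum : Aq = (\sum_(t < B | coprime t B)
    \sum_(A < b ^ J) ((q %| n A) && (B %| n A + t)))%N.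
  rewrite exchange_big /=; apply: eq_bigr => A _.
  by case: (q %| _)%N; rewrite /= ?sum_residue_coprime // big1.
have err_ge : (\sum_(t < B | coprime t B) (q * b ^ J * (K - 1) ^ W) <= err)%N.
  rewrite sum_nat_const leq_mul2r; apply/orP; right.
  by apply: leq_trans (max_card _) _; rewrite card_ord.
rewrite N_sum A_sum; split.
  apply: leq_trans (leq_add (leqnn _) err_ge).
  rewrite !big_distrr -big_split /=; apply: leq_sum => t _.
  by case: (key t).
apply: leq_trans (leq_add (leqnn _) err_ge).
rewrite !big_distrr -big_split /=; apply: leq_sum => t _.
by case: (key t).
Qed.

End BlockEquidistribution.

Local Close Scope ring_scope.

(** * Counting palindromes *)

Definition pstar (b n : nat) :=
  [&& 0 < n, coprime n (b ^ 3 - b) & n == digit_rev b n].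

Section Counting.
Variables (b X Mm : nat).
Hypothesis b_gt1 : 1 < b.
Hypothesis X_bounds : b ^ Mm.*2 <= X < b ^ Mm.+1.*2.

Let B := b ^ 2 - 1.
Let b' := b ^ 3 - b.
Let b_gt0 : 0 < b. Proof. exact: ltnW. Qed.
Let bX_gt0 i : 0 < b ^ i. Proof. by rewrite expn_gt0 b_gt0. Qed.
Let b'E : b' = b * B.
Proof. by rewrite /b' /B expnS mulnBr muln1. Qed.

Definition valid_half M A :=
  [&& b ^ M <= A, pal b M A <= X & coprime (pal b M A) b'].

Lemma coprime_b' n : coprime n b' = coprime n b && coprime n B.
Proof. by rewrite b'E coprimeMr. Qed.

(** Even length would give the factor [b + 1], which [n] cannot share with [b']. So the length is
    [2M + 1], the upper half determines [n], and [X < b^(2 Mm + 2)] forces [M <= Mm]. *)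
Lemma sum_pstar (g : nat -> nat) :
  \sum_(n < X.+1 | pstar b n) g n =
  \sum_(M < Mm.+1) \sum_(A < b ^ M.+1 | valid_half M A) g (pal b M A).
Proof.
have -> : \sum_(n < X.+1 | pstar b n) g n =
    \sum_(n <- [seq n <- iota 0 X.+1 | pstar b n]) g n.
  by rewrite big_filter -(big_mkord (pstar b) g) /index_iota subn0.
have -> : \sum_(M < Mm.+1) \sum_(A < b ^ M.+1 | valid_half M A) g (pal b M A) =
    \sum_(n <- [seq pal b M A | M <- iota 0 Mm.+1,
                 A <- [seq A <- iota 0 (b ^ M.+1) | valid_half M A]]) g n.
  rewrite big_allpairs_dep /= -(big_mkord xpredT (fun M => \sum_(A < b ^ M.+1 | valid_half M A) g (pal b M A))).
  rewrite /index_iota subn0.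
  apply: eq_bigr => M _; rewrite big_filter.
  by rewrite -(big_mkord (valid_half M) (fun A => g (pal b M A))) /index_iota subn0.
apply: perm_big; apply: uniq_perm.
- by rewrite filter_uniq ?iota_uniq.
- apply: allpairs_uniq_dep; first exact: iota_uniq.
    by move=> M _; rewrite filter_uniq ?iota_uniq.
  move=> [M A] [M' A'] /allpairsPdep[u [v [_ + [-> ->]]]] /allpairsPdep[u' [v' [_ + [-> ->]]]].
  rewrite !mem_filter !mem_iota !add0n => /andP[/and3P[le1 _ _] lt1] /andP[/and3P[le2 _ _] lt2] /= e.
  by have [-> ->] := pal_inj b_gt1 (introT andP (conj le1 lt1)) (introT andP (conj le2 lt2)) e.
move=> n; rewrite mem_filter mem_iota add0n.
apply/andP/allpairsPdep => [[/and3P[n0 cop /eqP nE] lt_n] | [M [A [lt_M + ->]]]]; last first.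
  rewrite mem_filter mem_iota add0n => /andP[/and3P[leA leX cop] ltA].
  split; last by rewrite ltnS.
  rewrite /pstar -/b' cop (pal_digit_rev b_gt1) ?leA // eqxx.
  rewrite (leq_trans (bX_gt0 M.*2)) //.
  by case/andP: (pal_bounds b_gt1 (introT andP (conj leA ltA))).
have [N nd bn] := num_digits_bounds b_gt1 n0.
have evN : ~~ odd N.
  apply/negP => oddN; have := even_length_dvd b_gt1 nd oddN nE.
  have dvdb : b.+1 %| b' by rewrite b'E dvdn_mull // /B -[1](exp1n 2) subn_sqr addn1 dvdn_mull.
  move=> dvd; have := dvdn_gcd b.+1 n b'; rewrite dvd dvdb (eqP cop) dvdn1; lia.
have NE : N = N./2.*2 by rewrite -[LHS]odd_double_half (negbTE evN).
rewrite NE in nd bn; set M := N./2 in nd bn.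
have [bA nA] := odd_length_pal b_gt1 nd nE.
exists M, (n %/ b ^ M); split => //.
  rewrite mem_iota add0n /= ltnNge; apply/negP => lt_M.
  have : b ^ Mm.+1.*2 <= b ^ M.*2 by rewrite leq_exp2l // leq_double.
  case/andP: X_bounds => _; case/andP: bn; lia.
rewrite mem_filter mem_iota add0n /valid_half -nA cop; case/andP: bA => -> ->.
by move: lt_n; rewrite leq0n /= ltnS => ->.
Qed.

(* [h] is the number formed by the leading digits. *)
Let block M J h (f : pred nat) :=
  \sum_(l < b ^ J | valid_half M (h * b ^ J + l)) f (pal b M (h * b ^ J + l)).

Lemma sum_blocks M J (f : pred nat) : J <= M.+1 ->
  \sum_(A < b ^ M.+1 | valid_half M A) f (pal b M A) =
  \sum_(h < b ^ (M.+1 - J)) block M J h f.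
Proof.
move=> leJ; have -> : b ^ M.+1 = b ^ (M.+1 - J) * b ^ J by rewrite -expnD subnK.
rewrite big_mkcond.
rewrite (big_ord_mul _ _ _ (fun A => if valid_half M A then nat_of_bool (f (pal b M A)) else 0)).
by apply: eq_bigr => h _; rewrite /block [RHS]big_mkcond.
Qed.

Lemma block_le M J h f : block M J h f <= b ^ J.
Proof.
rewrite /block big_mkcond -[X in _ <= X]card_ord -sum1_card; apply: leq_sum => l _.
by case: ifP => //; case: (f _).
Qed.

(** The weights at distance less than [J <= M] from the centre are multiples of [b], so coprimality
    with [b] is a condition on the prefix [h] only. *)
Lemma pal_mod_b M J h l : J <= M -> l < b ^ J ->
  coprime (pal b M (h * b ^ J + l)) b = coprime (pal b M (h * b ^ J)) b.
Proof.
move=> leJ lt_l; rewrite pal_add ?(leqW leJ) // -coprime_modl -modnDmr.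
suff /dvdnP[k ->] : b %| dot_digits b (pal_weight b M) J l.
  by rewrite modnMl addn0 coprime_modl.
apply: dvdn_sum => i _; rewrite dvdn_mull // /pal_weight; have lti := ltn_ord i.
case: ifP => _; first by rewrite dvdn_exp //; lia.
by rewrite dvdn_add // dvdn_exp //; lia.
Qed.

Lemma sum_expn_le n : \sum_(i < n) b ^ i.+1 <= 2 * b ^ n.
Proof.
elim: n => [|n IH]; first by rewrite big_ord0.
rewrite big_ord_recr /=; apply: leq_trans (leq_add IH (leqnn _)) _.
rewrite expnS; move: (b ^ n) b_gt1 => z; nia.
Qed.

Section Equidistribution.
Variables (q L W J : nat).
Let K := decay_const b.
Hypotheses (q_gt0 : 0 < q) (cop_bq : coprime b q) (cop_Bq : coprime B q).
Hypotheses (Lq : q * 2 ^ L <= 3 ^ L) (WJ : 1 + W * L.+2 <= J).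

(** A block whose prefix exceeds that of [X] is empty, and one whose prefix is smaller lies wholly
    below [X], so that [block_equidist] applies. The second summand of [err] pays for the single
    boundary block. *)
Lemma block_estimate M h : J <= M -> h < b ^ (M.+1 - J) ->
  let err := B * (q * b ^ J * (K - 1) ^ W) + (h == X %/ b ^ M %/ b ^ J) * (K ^ W * (q * b ^ J)) in
  (K ^ W * (q * block M J h (fun n => q %| n)) <= K ^ W * block M J h xpredT + err) /\
  (K ^ W * block M J h xpredT <= K ^ W * (q * block M J h (fun n => q %| n)) + err).
Proof.
move=> leJ lth err; have leJ1 := leqW leJ.
case: (ltngtP h (X %/ b ^ M %/ b ^ J)) => cmp; last first.
- rewrite /err cmp eqxx mul1n; split; apply: leq_trans (leq_addl _ _).
    apply: leq_trans (leq_addl _ _).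
    by rewrite !leq_mul2l block_le !orbT.
  apply: leq_trans (leq_addl _ _); rewrite leq_mul2l.
  rewrite (leq_trans (block_le _ _ _ _)) ?orbT //.
  by rewrite -{1}[b ^ J]mul1n leq_mul2r q_gt0 orbT.
- have zero f : block M J h f = 0.
    rewrite /block big1 // => l /and3P[_ leX _]; exfalso.
    have : h * b ^ J + l <= X %/ b ^ M.
      have lt_hl : h * b ^ J + l < b ^ M.+1.
        rewrite -(subnK leJ1) expnD; apply: leq_trans (_ : h.+1 * b ^ J <= _).
          by rewrite mulSn addnC ltn_add2r.
        by rewrite leq_mul2r lth orbT.
      by rewrite -(pal_divX b_gt1 lt_hl) leq_div2r.
    move: cmp; rewrite ltn_divLR // => cmp le; have := leq_trans cmp (leq_trans (leq_addr _ _) le).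
    by rewrite ltnn.
  by rewrite !zero !muln0.
(* Here the bound by [X] holds automatically, so validity splits into conditions on [h] and
   coprimality with [B]. *)
have blockE f : block M J h f = if (b ^ (M - J) <= h) && coprime (pal b M (h * b ^ J)) b then
   \sum_(l < b ^ J) (f (pal b M (h * b ^ J) + dot_digits b (pal_weight b M) J l) &&
     coprime (pal b M (h * b ^ J) + dot_digits b (pal_weight b M) J l) B) else 0.
  rewrite /block big_mkcond /=.
  have step (l : 'I_(b ^ J)) : (if valid_half M (h * b ^ J + l)
      then f (pal b M (h * b ^ J + l)) : nat else 0) =
      (if (b ^ (M - J) <= h) && coprime (pal b M (h * b ^ J)) b then
      f (pal b M (h * b ^ J) + dot_digits b (pal_weight b M) J l) &&
     coprime (pal b M (h * b ^ J) + dot_digits b (pal_weight b M) J l) B : nat else 0).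
    have -> : valid_half M (h * b ^ J + l) = [&& b ^ (M - J) <= h, coprime (pal b M (h * b ^ J)) b
      & coprime (pal b M (h * b ^ J) + dot_digits b (pal_weight b M) J l) B].
      rewrite /valid_half coprime_b' pal_mod_b // -pal_add //.
      have -> : pal b M (h * b ^ J + l) <= X.
        have lt1 : h * b ^ J + l < X %/ b ^ M.
          apply: leq_trans (_ : h.+1 * b ^ J <= _); first by rewrite mulSn addnC ltn_add2r.
          by rewrite -leq_divRL.
        have lt2 : h * b ^ J + l < b ^ M.+1.
          rewrite -(subnK leJ1) expnD; apply: leq_trans (_ : h.+1 * b ^ J <= _).
            by rewrite mulSn addnC ltn_add2r.
          by rewrite leq_mul2r lth orbT.
        rewrite leqNgt; apply/negP => gtX; move: lt1; rewrite -{1}(pal_divX b_gt1 lt2).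
        by rewrite ltnNge leq_div2r // ltnW.
      rewrite /=; congr (_ && _).
      rewrite -{1}(subnK leJ) expnD; apply/idP/idP => [le|le].
        rewrite leqNgt; apply/negP => lth'; move: le; rewrite leqNgt => /negP; apply.
        apply: leq_trans (_ : h.+1 * b ^ J <= _); first by rewrite mulSn addnC ltn_add2r.
        by rewrite leq_mul2r lth' orbT.
      by apply: leq_trans (leq_addr _ _); rewrite leq_mul2r le orbT.
    rewrite -pal_add //; case: (_ <= h) => //=; case: (coprime _ b) => //=.
    by case: (coprime _ B) => /=; rewrite ?andbT ?andbF.
  under eq_bigr do rewrite step.
  by case: ifP => // _; rewrite big1.
rewrite !blockE; case: ifP => _; last by rewrite !muln0.
have [h1 h2] := @block_equidist b M J q L W (pal b M (h * b ^ J)) b_gt1 q_gt0 cop_bq cop_Bq Lq WJ leJ1.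
split; rewrite /err addnA; apply: leq_trans (leq_addr _ _); [exact: h1 | exact: h2].
Qed.

(** Sums the block estimates over all prefixes and all lengths, with one boundary block per length.
    Lengths with [M < J] are too short for blocks and are bounded trivially by [b^J]. *)
Lemma equidist :
  let P := \sum_(n < X.+1 | pstar b n) 1 in
  let F := \sum_(n < X.+1 | pstar b n) (q %| n) in
  let err := q * (2 * b ^ Mm.+1 * B * (K - 1) ^ W + Mm.+1 * (K ^ W * b ^ J)) in
  (K ^ W * (q * F) <= K ^ W * P + err) /\ (K ^ W * P <= K ^ W * (q * F) + err).
Proof.
move=> P F err.
pose c (f : pred nat) M := \sum_(A < b ^ M.+1 | valid_half M A) f (pal b M A).
pose errM M := b ^ M.+1 * (B * (q * (K - 1) ^ W)) + K ^ W * (q * b ^ J).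
have c_le f M : c f M <= b ^ M.+1.
  rewrite /c big_mkcond -[X in _ <= X]card_ord -sum1_card; apply: leq_sum => l _.
  by case: ifP => //; case: (f _).
have est M : (K ^ W * (q * c (fun n => q %| n) M) <= K ^ W * c xpredT M + errM M) /\
             (K ^ W * c xpredT M <= K ^ W * (q * c (fun n => q %| n) M) + errM M).
  case: (ltnP M J) => cmp.
    have leb : b ^ M.+1 <= b ^ J by rewrite leq_exp2l.
    split; apply: leq_trans (leq_addl _ _); apply: leq_trans (leq_addl _ _).
      by rewrite !leq_mul // (leq_trans (c_le _ _)).
    apply: leq_mul => //; apply: leq_trans (c_le _ _) _; apply: leq_trans leb _.
    by rewrite leq_pmull.
  have cE f : c f M = \sum_(h < b ^ (M.+1 - J)) block M J h f by rewrite /c -sum_blocks // leqW.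
  rewrite !cE.
  have errE : \sum_(h < b ^ (M.+1 - J)) (B * (q * b ^ J * (K - 1) ^ W) +
      (h == X %/ b ^ M %/ b ^ J :> nat) * (K ^ W * (q * b ^ J))) <= errM M.
    rewrite big_split /= sum_nat_const card_ord leq_add //.
      rewrite [_ * b ^ J]mulnC -[b ^ J * _ * _]mulnA [B * _]mulnCA mulnA -expnD subnK ?leqW //.
    rewrite -big_distrl /= -{2}[K ^ W * _]mul1n leq_mul2r; apply/orP; right.
    set y := X %/ _ %/ _; case: (ltnP y (b ^ (M.+1 - J))) => cy.
      rewrite (bigD1 (Ordinal cy)) //= eqxx big1 // => i ne.
      by case: eqP => // e; case/eqP: ne; apply: val_inj.
    rewrite big1 // => i _; case: eqP => // e; have := ltn_ord i.
    by rewrite e ltnNge cy.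
  split; apply: leq_trans (leq_add (leqnn _) errE); rewrite !big_distrr -big_split /=;
    by apply: leq_sum => h _; case: (block_estimate cmp (ltn_ord h)).
have PE : P = \sum_(M < Mm.+1) c xpredT M.
  by rewrite /P (sum_pstar (fun=> 1)).
have FE : F = \sum_(M < Mm.+1) c (fun n => q %| n) M.
  by rewrite /F (sum_pstar (fun n => nat_of_bool (q %| n))).
have err_le : \sum_(M < Mm.+1) errM M <= err.
  rewrite big_split /= sum_nat_const card_ord -big_distrl /= /err mulnDr leq_add //.
    apply: leq_trans (leq_mul (sum_expn_le _) (leqnn _)) _.
    by apply: eq_leq; lia.
  by apply: eq_leq; lia.
by rewrite PE FE; split; apply: leq_trans (leq_add (leqnn _) err_le);
  rewrite !big_distrr -big_split /=; apply: leq_sum => M _; case: (est M).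
Qed.

End Equidistribution.

(** * Upper bound for the number of multiples of any modulus coprime to the base *)

Lemma pal_lt M A : pal b M A < b ^ M.*2.+1.
Proof.
rewrite pal_digits //.
by apply: (digits_sum_lt b_gt1 (c := fun i => digit b A (mirror M i))) => i; exact: digit_lt.
Qed.

(** The [J] lowest digits of the upper half govern the central [2J - 1] positions, which form a
    shifted shorter palindrome. *)
Lemma dot_digits_center M J l : 0 < J -> J <= M.+1 ->
  dot_digits b (pal_weight b M) J l = b ^ (M.+1 - J) * pal b J.-1 l.
Proof.
case: J => // J _ leJ; rewrite /pal /dot_digits big_distrr /=; apply: eq_bigr => i _.
rewrite mulnCA; congr (_ * _); rewrite /pal_weight subSS; have lti := ltn_ord i.
case: ifP => _; first by rewrite -expnD subnK.
by rewrite mulnDr -!expnD; congr (_ ^ _ + _ ^ _); lia.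
Qed.

(** Two multiples of [q] in one block differ by a power of [b] times a difference of palindromes
    below [b^(2J-1) <= q]. As [q] is coprime to [b], that difference is 0. *)
Lemma block_dvd_le1 M J h q : coprime b q -> 0 < J -> J <= M.+1 -> b ^ J.*2.-1 <= q ->
  block M J h (fun n => q %| n) <= 1.
Proof.
move=> cop J0 leJ leq_q; have JE : J.-1.*2.+1 = J.*2.-1 by clear -J0; lia.
have inj (l1 l2 : 'I_(b ^ J)) : q %| pal b M (h * b ^ J + l1) ->
    q %| pal b M (h * b ^ J + l2) -> pal b J.-1 l1 <= pal b J.-1 l2 -> l1 = l2.
  rewrite !(pal_add b_gt1) // !dot_digits_center // => d1 d2 le12.
  have : q %| b ^ (M.+1 - J) * (pal b J.-1 l2 - pal b J.-1 l1).
    by rewrite mulnBr -(subnDl (pal b M (h * b ^ J))) dvdn_sub.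
  rewrite Gauss_dvdr; last by rewrite coprime_sym coprimeXl.
  move=> dvd; have eqp : pal b J.-1 l1 = pal b J.-1 l2.
    apply/eqP; rewrite eqn_leq le12 /= -subn_eq0 -leqn0 leqNgt; apply/negP => pos.
    have := dvdn_leq pos dvd; apply/negP; rewrite -ltnNge.
    apply: leq_ltn_trans (leq_subr _ _) _; apply: leq_trans (pal_lt _ _) _.
    by rewrite JE.
  have lt (l : 'I_(b ^ J)) : l < b ^ J.-1.+1 by rewrite prednK.
  by apply/val_inj; rewrite /= -(pal_divX b_gt1 (lt l1)) eqp pal_divX.
rewrite /block -big_mkcondr sum1_card /=.
apply/card_le1_eqP => l1 l2 /andP[_ d1] /andP[_ d2].
case: (leqP (pal b J.-1 l1) (pal b J.-1 l2)) => [|/ltnW] le.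
  by apply: esym; apply: inj.
exact: inj.
Qed.

(** Squared form of the bound [O(b^Mm q^(-1/2))], which avoids roots: each block of [b^J] upper
    halves holds at most one multiple, with [b^J] of order [q^(1/2)]. *)
Lemma dvd_count_sqr q : 0 < q -> coprime b q ->
  (\sum_(n < X.+1 | pstar b n) (q %| n)) ^ 2 * q <= 4 * b ^ 3 * (b ^ Mm) ^ 2.
Proof.
move=> q0 cop; rewrite (sum_pstar (fun n => nat_of_bool (q %| n))).
set F := \sum_(_ < _) _.
have /andP[le_q lt_q] := trunc_log_bounds b_gt1 q0.
(* With [2J] equal to [e] or [e + 1], both [b^(2J-1) <= q] and [q < b^(2J+1)] hold. *)
set e := trunc_log b q in le_q lt_q; set J := uphalf e.
have Je : J.*2 = e + odd e by rewrite /J uphalf_half; have := odd_double_half e; lia.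
have FJ : F * b ^ J <= 2 * b ^ Mm.+1.
  apply: leq_trans (sum_expn_le _); rewrite big_distrl; apply: leq_sum => M _.
  case: (leqP J M.+1) => leJ; last first.
    rewrite big1 ?mul0n // => A /and3P[leA _ _]; apply/eqP; rewrite eqb0; apply/negP => dvd.
    have pal0 : 0 < pal b M A.
      case/andP: (pal_bounds b_gt1 (introT andP (conj leA (ltn_ord A)))) => le _.
      exact: leq_trans le.
    have := dvdn_leq pal0 dvd; apply/negP; rewrite -ltnNge.
    apply: leq_trans (pal_lt _ _) _; apply: leq_trans le_q; rewrite leq_exp2l //.
    by clear -Je leJ; lia.
  rewrite (sum_blocks (fun n => q %| n) leJ).
  have -> : b ^ M.+1 = b ^ (M.+1 - J) * b ^ J by rewrite -expnD subnK.
  rewrite leq_mul2r; apply/orP; right.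
  rewrite -[X in _ <= X]card_ord -sum1_card; apply: leq_sum => h _.
  case: (posnP J) => [J0|J0].
    by apply: leq_trans (block_le _ _ _ _) _; rewrite J0.
  apply: block_dvd_le1 => //; apply: leq_trans le_q; rewrite leq_exp2l //; clear -Je J0; lia.
apply: (@leq_trans ((F * b ^ J) ^ 2 * b)).
  rewrite expnMn -mulnA leq_mul2l; apply/orP; right; apply: leq_trans (ltnW lt_q) _.
  by rewrite -expnM -expnSr leq_exp2l //; clear -Je; lia.
apply: (@leq_trans ((2 * b ^ Mm.+1) ^ 2 * b)); first by rewrite leq_mul2r leq_sqr FJ orbT.
by rewrite !expnS expn0 !muln1; apply: eq_leq; lia.
Qed.

(** * Lower bound for the number of palindromes *)

Lemma expn2_mod j : b ^ j.*2 = 1 %[mod B].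
Proof.
rewrite -mul2n expnM -modnXm.
have -> : b ^ 2 %% B = 1 %% B.
  by rewrite -{1}(subnK (_ : 1 <= b ^ 2)) ?bX_gt0 // -/B addnC modnDr.
by rewrite modnXm exp1n.
Qed.

Lemma pal_weight_mod M j : 0 < j -> j.*2 <= M -> pal_weight b M j.*2 = b ^ M * 2 %[mod B].
Proof.
move=> j0 lej; rewrite /pal_weight double_eq0 eqn0Ngt j0 /= muln2 -[(b ^ M).*2]addnn.
rewrite -modnDm -[RHS]modnDm; congr ((_ + _) %% _).
  by rewrite expnD -modnMmr expn2_mod modnMmr muln1.
by rewrite -{2}(subnK lej) expnD -[RHS]modnMmr expn2_mod modnMmr muln1.
Qed.

(** Modulo [B] the central digit has weight [b^M] and each even position has weight [2 b^M]; the [h]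
    even positions [2, ..., 2h] can share out any [t <= h (b - 1)]. *)
Lemma exists_center_residue M a h t : a < b -> h.*2 <= M -> t <= h * b.-1 ->
  exists2 l, l < b ^ h.*2.+1 &
    dot_digits b (pal_weight b M) h.*2.+1 l = b ^ M * (a + t.*2) %[mod B].
Proof.
move=> lta; elim: h t => [|h IH] t leh let_.
  exists a; first by rewrite expn1.
  have -> : t = 0 by lia.
  rewrite /dot_digits big_ord1 /digit expn0 divn1 (modn_small lta) /pal_weight eqxx.
  by rewrite addn0 mulnC.
(* Greedy choice: position [2h + 2] takes as much of [t] as one digit can hold, and position
   [2h + 1] stays 0. *)
have lea' : minn t b.-1 < b by lia.
have [|l ltl dotl] := IH (t - minn t b.-1) ltac:(lia).
  by move: let_; rewrite mulSn; move: (h * b.-1) => u; lia.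
have ltl' : l < b ^ h.+1.*2 by rewrite (leq_trans ltl) // leq_exp2l // doubleS.
exists (minn t b.-1 * b ^ h.+1.*2 + l).
  rewrite expnS; apply: leq_trans (_ : (minn t b.-1).+1 * b ^ h.+1.*2 <= _).
    by rewrite mulSn addnC ltn_add2r.
  by rewrite leq_mul2r lea' orbT.
rewrite dot_digits_top //.
have -> : dot_digits b (pal_weight b M) h.+1.*2 l = dot_digits b (pal_weight b M) h.*2.+1 l.
  by rewrite doubleS {1}/dot_digits big_ord_recr /= digit_small // mul0n addn0.
rewrite -modnDm dotl -[(minn _ _ * _) %% _]modnMmr pal_weight_mod // modnMmr modnDm.
congr (_ %% _); rewrite mulnCA -mulnDr; congr (_ * _).
by have := geq_minl t b.-1; move: (minn _ _) => m; clear; lia.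
Qed.

(** The centre is chosen to make the total 1 modulo [B]. As [b^M] is its own inverse there, the
    target is [s = b^M (1 - c)], with [-c] written [c (B - 1)]; its parity goes to the central digit
    and its half to the even positions. *)
Lemma exists_coprime_center M c : b.+1.*2 <= M ->
  exists2 l, l < b ^ b.+1.*2.+1 &
    coprime (c + dot_digits b (pal_weight b M) b.+1.*2.+1 l) B.
Proof.
move=> leM; have B0 : 0 < B by rewrite /B subn_gt0 -{1}(exp1n 2) ltn_sqr.
pose s := (b ^ M * (1 + c * (B - 1))) %% B.
have lts : s < B by rewrite ltn_mod.
have [||l ltl dotl] := @exists_center_residue M (odd s) b.+1 s./2 _ leM.
- by case: (odd s); lia.
- have -> : b.+1 * b.-1 = B.
    by rewrite /B -[1](exp1n 2) subn_sqr addn1 mulnC subn1.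
  by have := odd_double_half s; lia.
exists l => //; rewrite -coprime_modl -modnDmr dotl odd_double_half modnDmr.
rewrite -modnDmr modnMmr mulnA -expnD addnn -modnMml expn2_mod modnMml mul1n modnDmr.
have -> : c + (1 + c * (B - 1)) = c * B + 1.
  by rewrite addnCA mulnBr muln1 subnKC ?leq_pmulr // addnC.
by rewrite modnMDl coprime_modl coprime1n.
Qed.

(** Length [2 Mm - 1] keeps every palindrome below [X]. Leading digit 1 forces last digit 1, hence
    coprimality with [b]; the [2b + 3] lowest digits of the upper half secure coprimality with [B],
    and the digits in between are free. *)
Lemma pstar_count_ge : b.*2 + 4 <= Mm ->
  b ^ Mm <= (\sum_(n < X.+1 | pstar b n) 1) * b ^ (b.*2 + 4).
Proof.
move=> leM; set M := Mm.-1; set J := b.+1.*2.+1.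
have JE : J = b.*2 + 3 by rewrite /J; lia.
have leJ : J <= M by rewrite /M; lia.
have M0 : 0 < M by lia.
rewrite (sum_pstar (fun=> 1)).
have ltM : M < Mm.+1 by rewrite /M; lia.
have -> : b ^ Mm = b ^ (M - J) * b ^ (b.*2 + 4).
  by rewrite -expnD; congr (_ ^ _); rewrite /M; lia.
rewrite leq_mul2r; apply/orP; right.
rewrite (bigD1 (Ordinal ltM)) //=; apply: leq_trans (leq_addr _ _).
rewrite (sum_blocks xpredT (leqW leJ)) subSn // expnS.
rewrite (big_ord_mul _ _ _ (fun h => block M J h xpredT)) /=.
rewrite (bigD1 (Ordinal b_gt1)) //=; apply: leq_trans (leq_addr _ _).
rewrite -[X in X <= _]card_ord -sum1_card; apply: leq_sum => l' _; rewrite mul1n.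
(* Prefix with leading digit 1 and arbitrary remaining digits [l']. *)
set h := b ^ (M - J) + l'.
have [l ltl cop] := @exists_coprime_center M (pal b M (h * b ^ J)) ltac:(lia).
rewrite /block (bigD1 (Ordinal ltl)) ?leq_addr //= -/J /valid_half coprime_b'.
rewrite {3}(pal_add b_gt1) ?leqW // cop andbT pal_mod_b //.
have hE : h * b ^ J = 1 * b ^ M + l' * b ^ J by rewrite /h mulnDl -expnD subnK // mul1n.
rewrite (leq_trans _ (leq_addr _ _)) /=; last by rewrite hE mul1n leq_addr.
apply/andP; split.
  apply: leq_trans (ltnW (pal_lt _ _)) _; case/andP: X_bounds => le _; apply: leq_trans le.
  by rewrite leq_exp2l // /M; lia.
rewrite hE pal_mod_b //; last by rewrite -{2}(subnK leJ) expnD ltn_mul2r bX_gt0 ltn_ord.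
rewrite -[_ * _]addn0 /pal dot_digits_top ?bX_gt0 //.
rewrite [dot_digits _ _ _ 0]big1 => [|i _]; last by rewrite digit_small ?bX_gt0.
rewrite mul1n add0n /pal_weight eqn0Ngt M0 /= subnn expn0 -coprime_modl.
have -> : M + M = (M + M).-1.+1 by lia.
by rewrite expnS mulnC modnMDl coprime_modl coprime1n.
Qed.

End Counting.

(** * The Moebius function *)

Lemma sum_multiples (V : nmodType) N p (Q : pred nat) (f : nat -> V) : 0 < p ->
  (forall d, Q d -> d <= N) ->
  (\sum_(d < N.+1 | Q d && (p %| d)%N) f d = \sum_(e < N.+1 | Q (p * e)%N) f (p * e)%N)%R.
Proof.
move=> p0 Qle.
have -> : (\sum_(d < N.+1 | Q d && (p %| d)%N) f d =
    \sum_(d <- [seq d <- iota 0 N.+1 | Q d && (p %| d)%N]) f d)%R.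
  by rewrite big_filter -(big_mkord (fun d => Q d && (p %| d)%N) f) /index_iota subn0.
have -> : (\sum_(e < N.+1 | Q (p * e)%N) f (p * e)%N =
    \sum_(d <- [seq (p * e)%N | e <- [seq e <- iota 0 N.+1 | Q (p * e)%N]]) f d)%R.
  rewrite big_map big_filter.
  by rewrite -(big_mkord (fun e => Q (p * e)) (fun e => f (p * e))) /index_iota subn0.
apply: perm_big; apply: uniq_perm; first by rewrite filter_uniq ?iota_uniq.
  rewrite map_inj_uniq ?filter_uniq ?iota_uniq // => x y /eqP.
  by rewrite eqn_mul2l eqn0Ngt p0 => /eqP.
move=> d; rewrite mem_filter mem_iota; apply/idP/mapP.
  case/andP=> /andP[Qd /dvdnP[e de]] ltd; exists e; last by rewrite mulnC.
  rewrite mem_filter mem_iota mulnC -de Qd /= add0n; move: ltd; rewrite add0n /= de.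
  by apply: leq_ltn_trans; rewrite leq_pmulr.
case=> e; rewrite mem_filter => /andP[Qe _] ->.
by rewrite Qe dvdn_mulr //= add0n ltnS Qle.
Qed.

Section Moebius.
Variable R : comNzRingType.
Implicit Types (n p d e k : nat).

Definition squarefree n := all (fun p => logn p n <= 1) (primes n).

(** As [primes 0] is empty, [moebius 0] is 1; the sums below are therefore restricted to positive
    indices. *)
Definition moebius n : R := if squarefree n then ((-1) ^+ size (primes n))%R else 0%R.

Lemma primes_mul_prime p e : prime p -> 0 < e -> ~~ (p %| e) ->
  perm_eq (primes (p * e)) (p :: primes e).
Proof.
move=> pp e0 npe; apply: uniq_perm; first exact: primes_uniq.
  by rewrite /= primes_uniq mem_primes pp e0 npe.
by move=> q; rewrite primesM ?(prime_gt0 pp) // (primes_prime pp) !inE.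
Qed.

Lemma moebius_mul_prime p e : prime p -> 0 < e ->
  moebius (p * e) = if (p %| e)%N then 0%R else (- moebius e)%R.
Proof.
move=> pp e0; have p0 := prime_gt0 pp; case: ifP => [pe|/negbT npe].
  rewrite /moebius ifN //; apply/allPn; exists p.
    by rewrite mem_primes pp muln_gt0 p0 e0 dvdn_mulr.
  by rewrite lognM // logn_prime // eqxx -ltnNge add1n ltnS logn_gt0 mem_primes pp e0 pe.
have perm := primes_mul_prime pp e0 npe.
rewrite /moebius (perm_size perm) /squarefree (perm_all _ perm) /=.
rewrite lognM // logn_prime // eqxx (lognE p e) (negbTE npe) !andbF addn0 /=.
rewrite (eq_in_all (a2 := fun q => logn q e <= 1)); last first.
  move=> q; rewrite mem_primes => /and3P[pq _ qe]; rewrite lognM // logn_prime //.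
  by case: eqP => // eq_qp; move: npe; rewrite -eq_qp qe.
by case: ifP; rewrite ?exprS ?mulN1r // oppr0.
Qed.

(** For [e] prime to [p], the terms at [e] and [p e] cancel, and the terms at multiples of [p^2]
    vanish. The abstract [Q] covers both conditions [d | n] and [d^k | n]. *)
Lemma moebius_cancel N p (Q : pred nat) : prime p ->
  (forall d, Q d -> 0 < d <= N) -> (forall e, 0 < e -> ~~ (p %| e) -> Q (p * e) = Q e) ->
  (\sum_(d < N.+1 | Q d) moebius d = 0)%R.
Proof.
move=> pp Qbd QM; have p0 := prime_gt0 pp.
rewrite (bigID (fun d : 'I_N.+1 => p %| d)) /=.
rewrite (sum_multiples _ p0); last by move=> d /Qbd/andP[].
rewrite (bigID (fun d : 'I_N.+1 => p %| d)) /= big1 ?add0r => [|e /andP[Qe pe]]; last first.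
  by rewrite moebius_mul_prime ?pe //; case/andP: (Qbd _ Qe); rewrite muln_gt0 p0.
apply/eqP; rewrite addr_eq0; apply/eqP; rewrite -sumrN.
rewrite (eq_bigr (fun e : 'I_N.+1 => (- moebius e)%R)) => [|e /andP[Qe npe]]; last first.
  by rewrite moebius_mul_prime ?(negbTE npe) //; case/andP: (Qbd _ Qe); rewrite muln_gt0 p0.
apply: eq_bigl => e; case: (boolP (p %| e)); rewrite ?andbF // => npe; rewrite !andbT.
case: (posnP e) => [->|e0]; last exact: QM.
by rewrite muln0.
Qed.

Lemma sum_moebius_divisors N n : 0 < n <= N ->
  (\sum_(d < N.+1 | (0 < d)%N && (d %| n)%N) moebius d = (n == 1)%N%:R)%R.
Proof.
case/andP=> n0 nN; case: (ltnP 1 n) => [n1|]; last first.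
  move=> n1; have -> : n = 1 by apply/eqP; rewrite eqn_leq n1.
  have lt1 : 1 < N.+1 by rewrite ltnS (leq_trans n0).
  rewrite (bigD1 (Ordinal lt1)) //= big1 ?addr0 // => i /andP[/andP[_]].
  by rewrite dvdn1 => /eqP i1 /eqP; case; apply: val_inj.
rewrite (gtn_eqF n1); apply: (moebius_cancel (p := pdiv n) (Q := fun d => (0 < d) && (d %| n)%N)).
- exact: pdiv_prime.
- by move=> d /andP[-> dn]; apply: leq_trans nN; exact: dvdn_leq.
move=> e e0 npe; rewrite muln_gt0 pdiv_gt0 e0 /= Gauss_dvd ?pdiv_dvd //.
by rewrite prime_coprime ?pdiv_prime.
Qed.

Lemma sum_moebius_power_free N k n : 0 < k -> 0 < n <= N -> power_free k n ->
  (\sum_(d < N.+1 | (0 < d)%N && (d ^ k %| n)%N) moebius d = 1)%R.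
Proof.
move=> k0 /andP[n0 nN] free.
have lt1 : 1 < N.+1 by rewrite ltnS (leq_trans n0).
rewrite (bigD1 (Ordinal lt1)) /=; last by rewrite exp1n dvd1n.
rewrite big1 ?addr0 // => i /andP[/andP[i0 dvd] /eqP ne].
have i1 : 1 < i by rewrite ltn_neqAle i0 andbT; apply/eqP => e; apply: ne; exact: val_inj.
by move: (free _ i1); rewrite dvd.
Qed.

Lemma sum_moebius_not_power_free N k n : 0 < k -> 0 < n <= N -> ~ power_free k n ->
  (\sum_(d < N.+1 | (0 < d)%N && (d ^ k %| n)%N) moebius d = 0)%R.
Proof.
move=> k0 /andP[n0 nN] nfree.
have bd d : 1 < d -> d ^ k %| n -> d <= n.
  move=> d1 /(dvdn_leq n0); apply: leq_trans; rewrite -{1}[d]expn1 leq_exp2l //.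
have [d /andP[d1 dvd]] : exists d : 'I_n.+1, (1 < d) && (d ^ k %| n).
  apply/existsP/contraT => /existsPn h; case: nfree => d d1; apply/negP => dvd.
  have ltd : d < n.+1 by rewrite ltnS bd.
  by move: (h (Ordinal ltd)); rewrite /= d1 dvd.
have pp := pdiv_prime d1.
apply: (moebius_cancel (p := pdiv d) (Q := fun e => (0 < e) && (e ^ k %| n)%N)) => //.
  move=> e /andP[e0 en]; rewrite e0 /=; apply: leq_trans nN; case: (ltnP 1 e) => e1.
    exact: bd.
  exact: leq_trans e1 n0.
(* Since [p^k] divides [n] and is coprime to [e^k], [(p e)^k] divides [n] exactly when [e^k]
   does. *)
move=> e e0 npe; rewrite muln_gt0 pdiv_gt0 e0 /= expnMn Gauss_dvd.
  by rewrite (dvdn_trans _ dvd) // dvdn_exp2r // pdiv_dvd.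
by rewrite coprime_pexpl // coprime_pexpr // prime_coprime.
Qed.

End Moebius.

Lemma norm_moebius_le1 (R : numDomainType) n : (`|moebius R n| <= 1)%R.
Proof. by rewrite /moebius; case: ifP; rewrite ?normr0 ?ler01 // normrX normrN1 expr1n. Qed.

(* Multiplying out: the coefficient of [n ^- k] is [\sum_(d | n) moebius d]. *)
Lemma moebius_convolution (F : fieldType) N k m : 0 < N ->
  (\sum_(d < N.+1 | (0 < d)%N && coprime d m) moebius F d * d%:R ^- k *
     \sum_(e < N.+1 | [&& 0 < e, d * e <= N & coprime e m]%N) e%:R ^- k = 1)%R.
Proof.
move=> N0.
transitivity (\sum_(n < N.+1 | (0 < n)%N && coprime n m)
    \sum_(d < N.+1 | (0 < d)%N && (d %| n)%N) moebius F d * n%:R ^- k)%R; last first.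
  have lt1 : 1 < N.+1 by [].
  rewrite (bigD1 (Ordinal lt1)) /=; last by rewrite coprime1n.
  rewrite -big_distrl /= sum_moebius_divisors // expr1n invr1 mulr1 big1 ?addr0 //.
  move=> i /andP[/andP[i0 _] ne]; rewrite -big_distrl /= sum_moebius_divisors; last first.
    by rewrite i0 -ltnS ltn_ord.
  case: eqP => [i1|]; last by rewrite mul0r.
  by case/eqP: ne; apply: val_inj.
rewrite [RHS](exchange_big_dep (fun d : 'I_N.+1 => (0 < d) && coprime d m)) /=; last first.
  move=> n d /andP[n0 cop] /andP[d0 dn]; rewrite d0 /=; exact: coprime_dvdl dn cop.
apply: eq_bigr => d /andP[d0 copd].
rewrite [RHS](eq_bigl (fun n : 'I_N.+1 => [&& 0 < n, n <= N & coprime n m] && (d %| n))); last first.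
  by move=> n; rewrite d0 -[n <= N]ltnS ltn_ord.
rewrite (sum_multiples (Q := fun n => [&& 0 < n, n <= N & coprime n m])
  (fun n => moebius F d * n%:R ^- k)%R d0); last by move=> n /and3P[].
rewrite big_distrr /=; apply: eq_big => e /=; first by rewrite muln_gt0 d0 coprimeMl copd.
by move=> _; rewrite natrM exprMn invfM mulrA.
Qed.

(** * Partial zeta functions *)

Local Open Scope ring_scope.

Section PartialZeta.
Import numFieldNormedType.Exports.
Variable R : realType.
Implicit Types (P : pred nat) (k N : nat).

Definition zeta_partial k P N : R := \sum_(e < N.+1 | (0 < e)%N && P e) e%:R ^- k.
Definition zeta_restr k P : R := limn (zeta_partial k P).

Lemma zeta_partialS k P N :
  zeta_partial k P N.+1 = zeta_partial k P N + (if P N.+1 then N.+1%:R ^- k else 0).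
Proof.
rewrite /zeta_partial big_mkcond big_ord_recr /= -big_mkcond /=.
by congr (_ + _).
Qed.

(** Comparison with [1 / (n (n + 1))], which telescopes and gives the tail bound [1/N]. *)
Lemma zeta_term_le k n : (2 <= k)%N -> (0 < n)%N ->
  n.+1%:R ^- k <= n%:R^-1 - n.+1%:R^-1 :> R.
Proof.
move=> k2 n0; have n1 : 1 <= n.+1%:R :> R by rewrite ler1n.
have np : 0 < n%:R :> R by rewrite ltr0n.
apply: (@le_trans _ _ (n.+1%:R ^- 2)).
  by rewrite lef_pV2 ?posrE ?exprn_gt0 ?ltr0n // ler_weXn2l.
have -> : n%:R^-1 - n.+1%:R^-1 = (n%:R * n.+1%:R)^-1 :> R.
  rewrite -natr1; field; apply/andP; split; lra.
rewrite lef_pV2 ?posrE ?exprn_gt0 ?mulr_gt0 ?ltr0n //.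
by rewrite expr2 ler_pM2r ?ltr0n // ler_nat.
Qed.

Lemma zeta_partial_tail k P N N' : (2 <= k)%N -> (0 < N)%N -> (N <= N')%N ->
  0 <= zeta_partial k P N' - zeta_partial k P N <= N%:R^-1 - N'%:R^-1.
Proof.
move=> k2 N0 /subnK <-; elim: (N' - N)%N => [|n IH]; first by rewrite add0n !subrr lexx.
rewrite addSn zeta_partialS.
have h := @zeta_term_le k (n + N) k2 ltac:(lia).
have h0 : 0 <= (n + N).+1%:R ^- k :> R by rewrite invr_ge0 exprn_ge0 ?ler0n.
move: IH h h0; move: (zeta_partial k P (n + N)) (zeta_partial k P N) => z z'.
move: (N%:R^-1) ((n + N)%:R^-1) ((n + N).+1%:R^-1) ((n + N).+1%:R ^- k) => u v w t.
by case/andP=> IH1 IH2 h h0; case: ifP => _; apply/andP; split; lra.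
Qed.

Lemma zeta_partial_homo k P : (2 <= k)%N ->
  {homo zeta_partial k P : n m / (n <= m)%N >-> n <= m}.
Proof.
move=> k2 n m; case: n => [|n] nm.
  rewrite {1}/zeta_partial big1 => [|[[]]] //.
  by apply: sumr_ge0 => e _; rewrite invr_ge0 exprn_ge0 ?ler0n.
by case/andP: (zeta_partial_tail P k2 (isT : (0 < n.+1)%N) nm); rewrite subr_ge0.
Qed.

Lemma zeta_partial_cvg k P : (2 <= k)%N -> cvgn (zeta_partial k P).
Proof.
move=> k2; apply: nondecreasing_is_cvgn; first exact: zeta_partial_homo.
exists (zeta_partial k P 1 + 1) => _ [n _ <-].
apply: le_trans (zeta_partial_homo P k2 (leqnSn n)) _.
case/andP: (zeta_partial_tail P k2 (isT : (0 < 1)%N) (isT : (1 <= n.+1)%N)) => _ h.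
by rewrite -lerBlDl; apply: le_trans h _; rewrite invr1 gerBl invr_ge0 ler0n.
Qed.

Lemma zeta_restr_tail k P N : (2 <= k)%N -> (0 < N)%N ->
  0 <= zeta_restr k P - zeta_partial k P N <= N%:R^-1.
Proof.
move=> k2 N0; apply/andP; split.
  by rewrite subr_ge0; apply: nondecreasing_cvgn_le; [exact: zeta_partial_homo | exact: zeta_partial_cvg].
rewrite lerBlDr; apply: limr_le; first exact: zeta_partial_cvg.
exists N => // n /= Nn; case/andP: (zeta_partial_tail P k2 N0 Nn) => _ h.
by rewrite -lerBlDr; apply: le_trans h _; rewrite gerBl invr_ge0 ler0n.
Qed.

Lemma zeta_restr_bounds k P : (2 <= k)%N -> P 1%N -> 1 <= zeta_restr k P <= 2.
Proof.
move=> k2 P1; have := @zeta_restr_tail k P 1 k2 isT.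
have -> : zeta_partial k P 1 = 1.
  rewrite zeta_partialS P1 /zeta_partial big1 ?add0r => [|[[]]] //.
  by rewrite expr1n invr1.
by rewrite invr1 => /andP[h1 h2]; apply/andP; split; lra.
Qed.

Lemma zeta_restrT k : (2 <= k)%N -> zeta_restr k xpredT = zeta (k%:R : R).
Proof.
move=> k2; rewrite /zeta_restr /zeta; congr (limn _); apply/funext => n.
rewrite /series /= big_mkord; elim: n => [|n IH].
  by rewrite big_ord0 /zeta_partial big1 // => -[[]].
by rewrite zeta_partialS IH big_ord_recr /= /riemannR powR_mulrn ?ler0n.
Qed.

(** Removes one Euler factor: in the partial sum up to [p M], the multiples of [p] contribute [p^-k]
    times the partial sum up to [M]. *)
Lemma zeta_restr_sieve k P p : (2 <= k)%N -> prime p -> (forall e, P (p * e)%N = P e) ->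
  zeta_restr k (fun e => ~~ (p %| e)%N && P e) = zeta_restr k P * (1 - p%:R ^- k).
Proof.
move=> k2 pp Pp; set P' := fun e => _; have p0 := prime_gt0 pp.
have split_sum M : zeta_partial k P (p * M) =
    zeta_partial k P' (p * M) + p%:R ^- k * zeta_partial k P M.
  rewrite {1}/zeta_partial (bigID (fun e : 'I_(p * M).+1 => (p %| e)%N)) /= addrC; congr (_ + _).
    by apply: eq_bigl => e; rewrite /P' -andbA [P e && _]andbC.
  rewrite (eq_bigl (fun e : 'I_(p * M).+1 => ([&& 0 < e, e <= p * M & P e] && (p %| e))%N)); last first.
    by move=> e; rewrite -[(e <= _)%N]ltnS ltn_ord.
  rewrite (sum_multiples (Q := fun e => [&& 0 < e, e <= p * M & P e]%N) (fun e => e%:R ^- k) p0).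
    rewrite (eq_bigl (fun e : 'I_(p * M).+1 => ((0 < e) && P e) && (e < M.+1))%N).
      rewrite -(big_ord_widen_cond (p * M).+1 (fun e => (0 < e)%N && P e) (fun e => (p * e)%:R ^- k)).
        rewrite /zeta_partial big_distrr /=; apply: eq_bigr => e _.
        by rewrite natrM exprMn invfM.
      by rewrite ltnS leq_pmull.
    by move=> e; rewrite muln_gt0 p0 leq_pmul2l // Pp ltnS; case: (0 < e)%N; case: (P e); case: (e <= M)%N.
  by move=> e /and3P[].
(* Passage to the limit: the tail bounds put the discrepancy [x] below [3/M] for every [M], so it is
   not positive. *)
apply/eqP; rewrite -subr_eq0 -normr_le0 leNgt; apply/negP.
set x := `|_| => x0.
have bound M : (0 < M)%N -> x <= 3 / M%:R.
  move=> M0; have pM0 : (0 < p * M)%N by rewrite muln_gt0 p0.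
  case/andP: (zeta_restr_tail P k2 M0) => a1 a2.
  case/andP: (zeta_restr_tail P k2 pM0) => b1 b2.
  case/andP: (zeta_restr_tail P' k2 pM0) => c1 c2.
  have s := split_sum M.
  have hM : (p * M)%:R^-1 <= M%:R^-1 :> R.
    by rewrite lef_pV2 ?posrE ?ltr0n // ler_nat leq_pmull.
  set y := p%:R ^- k in s *.
  have y0 : 0 <= y by rewrite /y invr_ge0 exprn_ge0 ?ler0n.
  have y1 : y <= 1.
    by rewrite /y invf_le1 ?exprn_gt0 ?ltr0n // exprn_ege1 // ler1n.
  rewrite /x ler_norml.
  set z := zeta_restr k P in a1 a2 b1 b2 *; set w := zeta_partial k P M in s a1 a2 *.
  set v := M%:R^-1 in a2 hM *.
  have e1 : 0 <= y * (z - w) by rewrite mulr_ge0.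
  have e2 : y * (z - w) <= v by rewrite (le_trans _ a2) // ler_piMl.
  by rewrite mulrBr in e1 e2; rewrite mulrBr mulr1 [z * y]mulrC; apply/andP; split; lra.
have := truncnS_gt (3 / x); set M := (Num.truncn (3 / x)).+1 => hM.
have := bound M isT; rewrite leNgt => /negP; apply.
by rewrite ltr_pdivrMr ?ltr0n // mulrC -ltr_pdivrMr.
Qed.

Lemma zeta_restr_primes k (s : seq nat) : (2 <= k)%N -> uniq s -> all prime s ->
  zeta_restr k (fun e => all (fun p => ~~ (p %| e)%N) s) =
  zeta (k%:R : R) * \prod_(p <- s) (1 - p%:R ^- k).
Proof.
move=> k2; elim: s => [|p s IH] /=; first by rewrite big_nil mulr1 -zeta_restrT.
case/andP=> ps us /andP[pp prs]; rewrite big_cons mulrCA mulrC -IH //.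
apply: zeta_restr_sieve => // e; apply: eq_in_all => q qs.
have pq : prime q := allP prs _ qs; rewrite Euclid_dvdM // dvdn_prime2 //.
by case: eqP => // qp; move: ps; rewrite -qp qs.
Qed.

Lemma coprime_all_primes e m : (0 < e)%N -> (0 < m)%N ->
  coprime e m = all (fun p => ~~ (p %| e)%N) (primes m).
Proof.
move=> e0 m0; rewrite coprime_has_primes // -all_predC.
apply: eq_in_all => p /=; rewrite mem_primes => /and3P[pp _ _].
by rewrite mem_primes pp e0.
Qed.

Lemma zeta_restr_coprime k m : (2 <= k)%N -> (0 < m)%N ->
  zeta_restr k (coprime^~ m) =
  zeta (k%:R : R) * \prod_(p <- primes m) (1 - p%:R ^- k).
Proof.
move=> k2 m0; rewrite -zeta_restr_primes ?primes_uniq //; last first.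
  by apply/allP => p; rewrite mem_primes => /and3P[].
congr (limn _); apply/funext => N; apply: eq_bigl => e.
by case: (posnP e) => // e0; rewrite coprime_all_primes.
Qed.

(** The exact identity [moebius_convolution] has the partial sum up to [N/d] in place of [Z], at a
    cost of at most [2d/N]. With [d^-k <= d^-3] the costs add up to [(2/N)] times a sum of [d^-2],
    which is at most 2. *)
Lemma moebius_truncated k m N : (3 <= k)%N -> (0 < N)%N ->
  `|zeta_restr k (coprime^~ m) *
    \sum_(d < N.+1 | (0 < d)%N && coprime d m) moebius R d * d%:R ^- k - 1| <= 4 / N%:R.
Proof.
move=> k3 N0; have k2 : (2 <= k)%N by lia.
set Z := zeta_restr k _.
have inner (d : nat) : (0 < d)%N -> \sum_(e < N.+1 | [&& 0 < e, d * e <= N & coprime e m]%N) e%:R ^- k =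
    zeta_partial k (coprime^~ m) (N %/ d).
  move=> d0; rewrite /zeta_partial (big_ord_widen_cond N.+1 (fun e => (0 < e)%N && coprime e m)
    (fun e => e%:R ^- k)); last by rewrite ltnS leq_div.
  apply: eq_bigl => e; rewrite ltnS leq_divRL // mulnC.
  by case: (0 < e)%N; case: (coprime _ _); rewrite ?andbT ?andbF.
rewrite -[X in `|_ - X|](@moebius_convolution R N k m N0) big_distrr /= -sumrB.
apply: le_trans (ler_norm_sum _ _ _) _.
apply: (@le_trans _ _ (\sum_(d < N.+1 | (0 < d)%N && coprime d m) 2 / N%:R * d%:R ^- 2)).
  apply: ler_sum => d /andP[d0 _]; rewrite inner // [Z * _]mulrC -mulrBr -[moebius R d * _ * _]mulrA normrM.
  have dN : (d <= N)%N by rewrite -ltnS ltn_ord.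
  have q0 : (0 < N %/ d)%N by rewrite divn_gt0.
  rewrite -[X in _ <= X]mul1r; apply: ler_pM => //; first exact: norm_moebius_le1.
  rewrite normrM ger0_norm ?invr_ge0 ?exprn_ge0 ?ler0n //.
  case/andP: (zeta_restr_tail (coprime^~ m) k2 q0) => h1 h2; rewrite ger0_norm //.
  have dp : 0 < d%:R :> R by rewrite ltr0n.
  have h3 : d%:R ^- k <= d%:R ^- 3 :> R.
    by rewrite lef_pV2 ?posrE ?exprn_gt0 // ler_weXn2l // ler1n.
  have h4 : (N %/ d)%:R^-1 <= 2 * d%:R / N%:R :> R.
    rewrite ler_pdivlMr ?ltr0n // mulrC ler_pdivrMr ?ltr0n // -!natrM ler_nat.
    have := ltn_ceil N d0; nia.
  have -> : 2 / N%:R * d%:R ^- 2 = d%:R ^- 3 * (2 * d%:R / N%:R) :> R.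
    by field; rewrite !gt_eqF ?ltr0n.
  apply: ler_pM; rewrite ?invr_ge0 ?exprn_ge0 ?ler0n //.
  exact: le_trans h2 h4.
rewrite -big_distrr /=.
apply: (@le_trans _ _ (2 / N%:R * 2)); last by rewrite le_eqVlt; apply/orP; left; apply/eqP; field; rewrite gt_eqF ?ltr0n.
apply: ler_wpM2l; first by rewrite divr_ge0 ?ler0n.
case/andP: (zeta_restr_tail (coprime^~ m) (leqnn 2) N0) => h1 _.
case/andP: (@zeta_restr_bounds 2 (coprime^~ m) (leqnn 2) (coprime1n _)) => _ h2.
by rewrite subr_ge0 in h1; exact: le_trans h1 h2.
Qed.

End PartialZeta.

Local Close Scope ring_scope.

(** * The main estimate *)

(** By the first two binomial terms, [K^K >= (K-1)^K + K (K-1)^(K-1) >= 2 (K-1)^K]; so [K] windows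
    halve the error. *)
Lemma half_decay K n : 0 < K -> 2 ^ n * (K - 1) ^ (n * K) <= K ^ (n * K).
Proof.
case: n => [|n] K0; first by rewrite !mul0n !expn0.
rewrite -[(n.+1 * K)%N]mulnC !expnM -expnMn leq_exp2r //.
have step j : j * (K - 1) ^ j.-1 + (K - 1) ^ j <= K ^ j.
  elim: j => [|j IH] //; rewrite !expnS; apply: leq_trans (_ : K * (j * (K - 1) ^ j.-1 + (K - 1) ^ j) <= _); last by rewrite leq_mul2l IH orbT.
  case: j {IH} => [|j]; first by rewrite !expn0; lia.
  rewrite /= !expnS; move: ((K - 1) ^ j) => z; case: K K0 => // K _; rewrite subSS subn0.
  nia.
move: (step K); case: K K0 {step} => // K _; rewrite subSS subn0 /= => h.
by apply: leq_trans h; rewrite !expnS; lia.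
Qed.

Local Open Scope ring_scope.

Section MainEstimate.
Variables (R : realType) (b X Mm k s : nat).
Hypothesis b_gt1 : (1 < b)%N.
Hypothesis X_bounds : (b ^ Mm.*2 <= X < b ^ Mm.+1.*2)%N.
Hypothesis k_ge3 : (3 <= k)%N.
(* Makes [scale_const ^ 2] at least [450 * decay_const b]. *)
Definition scale_const := (60 * b ^ 2 * b.+1)%N.
Hypothesis s_gt0 : (0 < s)%N.
Hypothesis sM : ((scale_const * s) ^ 2 <= Mm)%N.

Let B := (b ^ 2 - 1)%N.
Let b' := (b ^ 3 - b)%N.
Let K := decay_const b.
Let T : R := b%:R ^+ Mm.
Let b_gt0 : (0 < b)%N. Proof. exact: ltnW. Qed.
Let b'E : b' = (b * B)%N. Proof. by rewrite /b' /B expnS mulnBr muln1. Qed.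
Let T_gt0 : 0 < T. Proof. by rewrite exprn_gt0 ?ltr0n. Qed.

Definition total_count : R := (\sum_(n < X.+1 | pstar b n) 1)%N%:R.
Definition dvd_count d : R := (\sum_(n < X.+1 | pstar b n) (d ^ k %| n))%N%:R.

Lemma scale_bounds : (4 * (105 * K * s ^ 2) <= Mm)%N /\ (4 * (3 * s) <= Mm)%N.
Proof.
have K0 : (0 < K)%N := decay_const_gt0 b_gt0.
have h : (450 * K * s ^ 2 <= Mm)%N.
  apply: leq_trans sM; rewrite expnMn leq_mul2r; apply/orP; right.
  rewrite /K /scale_const /decay_const.
  have -> : ((60 * b ^ 2 * b.+1) ^ 2 = 225 * b * (16 * b ^ 3 * b.+1 ^ 2))%N by ring.
  by rewrite leq_mul2r; apply/orP; right; lia.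
have hs : (s <= s ^ 2)%N by rewrite expnS expn1 leq_pmulr.
have hK : (s ^ 2 <= K * s ^ 2)%N by rewrite leq_pmull.
by move: h hs hK; rewrite -!mulnA; move: (K * s ^ 2)%N (s ^ 2)%N => u v; lia.
Qed.

(** The factors [Mm + 1], [b^J] and [8^s] are each bounded by [b^(Mm/4)], the first up to a factor
    4. This is the cost of the boundary blocks. *)
Lemma small_modulus_err : (Mm.+1 * b ^ (1 + 4 * s * K * (24 * s).+2) * 8 ^ s <= 4 * b ^ Mm)%N.
Proof.
have [h1 h2] := scale_bounds; set h := (Mm %/ 4)%N.
have K0 : (0 < K)%N := decay_const_gt0 b_gt0.
have hJ : (1 + 4 * s * K * (24 * s).+2 <= h)%N.
  rewrite leq_divRL //; apply: leq_trans h1; rewrite mulnC leq_mul2l /=.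
  have e1 : (4 * s * K * (24 * s).+2 = 96 * (K * s ^ 2) + 8 * (K * s))%N.
    by rewrite -addn2; ring.
  have e2 : (K * s <= K * s ^ 2)%N by rewrite leq_mul2l leq_pmulr ?orbT.
  have e3 : (0 < K * s)%N by rewrite muln_gt0 K0.
  by rewrite e1 -mulnA; move: (K * s ^ 2)%N (K * s)%N e2 e3; lia.
have hs : (3 * s <= h)%N by rewrite leq_divRL // mulnC.
have hM : (Mm.+1 <= 4 * 2 ^ h)%N.
  have := ltn_expl h (isT : (1 < 2)%N); have := ltn_ceil Mm (isT : (0 < 4)%N); rewrite -/h.
  by move: (2 ^ h)%N => z; lia.
have h3 : (8 ^ s <= b ^ h)%N.
  rewrite -[8%N]/(2 ^ 3)%N -expnM; apply: leq_trans (leq_pexp2l _ hs) _ => //.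
  by rewrite leq_exp2r //; lia.
have h4 : (Mm.+1 <= 4 * b ^ h)%N.
  apply: leq_trans hM _; rewrite leq_mul2l /=; case: (posnP h) => [->|h0] //.
  by rewrite leq_exp2r.
apply: (@leq_trans (4 * b ^ h * b ^ h * b ^ h)%N).
  by rewrite leq_mul // leq_mul // leq_pexp2l.
rewrite -!mulnA leq_mul2l /= -!expnD leq_pexp2l //.
by have := leq_divM Mm 4; rewrite -/h; lia.
Qed.

Lemma total_count_le : total_count <= 2 * b%:R ^+ 2 * T.
Proof.
have h := @dvd_count_sqr b X Mm b_gt1 X_bounds 1 isT (coprimen1 b).
rewrite (eq_bigr (fun=> 1%N)) in h; last by move=> i _; rewrite dvd1n.
rewrite /total_count /T -!natrX -!natrM ler_nat -leq_sqr.
rewrite muln1 in h; apply: leq_trans h _; rewrite 2!expnMn leq_mul2r; apply/orP; right.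
by rewrite -expnM leq_mul2l leq_pexp2l.
Qed.

Lemma dvd_count_le d : (0 < d)%N -> coprime b d ->
  dvd_count d ^+ 2 * d%:R ^+ k <= (2 * b%:R ^+ 2 * T) ^+ 2.
Proof.
move=> d0 cop; have dk0 : (0 < d ^ k)%N by rewrite expn_gt0 d0.
have copk : coprime b (d ^ k) by rewrite coprimeXr.
have h := dvd_count_sqr b_gt1 X_bounds dk0 copk.
rewrite /dvd_count /T -!natrX -!natrM -!natrX ler_nat.
apply: leq_trans h _; rewrite 2!expnMn leq_mul2r; apply/orP; right.
by rewrite -expnM leq_mul2l leq_pexp2l.
Qed.

Definition local_const : R := 2 * b%:R * B%:R + 4 + 4 * b%:R ^+ 2.

(** Applies [equidist] to [q = d^k] with [L = 24 s] and [W = 4 s K]. *)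
Lemma dvd_count_small d : (0 < d)%N -> coprime d b' -> (d ^ k <= 2 ^ (12 * s))%N ->
  `|dvd_count d - total_count * d%:R ^- k| <= local_const * T / 8 ^+ s.
Proof.
move=> d0; rewrite b'E coprimeMr coprime_sym => /andP[copb copB] small.
have K0 : (0 < K)%N := decay_const_gt0 b_gt0.
set q := (d ^ k)%N in small; have q0 : (0 < q)%N by rewrite expn_gt0 d0.
have copbq : coprime b q by rewrite coprimeXr.
have copBq : coprime B q by rewrite coprime_sym coprimeXl.
(* Reduces to [8^(12 s) <= 9^(12 s)]. *)
have Lq : (q * 2 ^ (24 * s) <= 3 ^ (24 * s))%N.
  apply: leq_trans (leq_mul small (leqnn _)) _; rewrite -expnD.
  have -> : (12 * s + 24 * s = 3 * (12 * s))%N by lia.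
  have -> : (24 * s = 2 * (12 * s))%N by lia.
  by rewrite (expnM 2 3) (expnM 3 2) leq_exp2r ?muln_gt0 //.
(* By [half_decay], these windows save [2^(4 s)], which exceeds the required [8^s]. *)
set W := (4 * s * K)%N; set J := (1 + W * (24 * s).+2)%N.
have [h1 h2] := @equidist b X Mm b_gt1 X_bounds q (24 * s) W J q0 copbq copBq Lq (leqnn _).
set P := (\sum_(n < X.+1 | pstar b n) 1)%N in h1 h2.
set F := (\sum_(n < X.+1 | pstar b n) (q %| n))%N in h1 h2.
rewrite -/K -/B in h1 h2; set err := (q * (_ + _))%N in h1 h2.
rewrite /dvd_count /total_count -/q -/F -/P -natrX -/q.
have KW0 : 0 < (K ^ W)%:R :> R by rewrite ltr0n expn_gt0 K0.
have qp : 0 < q%:R :> R by rewrite ltr0n.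
have dist : `|(K ^ W * (q * F))%:R - (K ^ W * P)%:R| <= err%:R :> R.
  by rewrite ler_distl lerBlDr -!natrD !ler_nat h1 h2.
have bound : `|F%:R - P%:R / q%:R| <= err%:R / ((K ^ W)%:R * q%:R) :> R.
  rewrite ler_pdivlMr ?mulr_gt0 //; apply: le_trans dist.
  rewrite -{1}(gtr0_norm (mulr_gt0 KW0 qp)) -normrM le_eqVlt; apply/orP; left; apply/eqP.
  by congr `|_|; rewrite !natrM; field; rewrite gt_eqF.
apply: le_trans bound _.
rewrite ler_pdivlMr ?exprn_gt0 ?ltr0n // mulrAC ler_pdivrMr ?mulr_gt0 //.
have hd : (2 ^ (4 * s) * (K - 1) ^ W <= K ^ W)%N by exact: half_decay.
have hs := small_modulus_err; rewrite -/W -/J in hs.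
have nat_bound : (err * 8 ^ s <= q * K ^ W * ((2 * b * B + 4) * b ^ Mm))%N.
  rewrite /err -!mulnA leq_mul2l; apply/orP; right.
  rewrite mulnDl mulnDl mulnDr leq_add //.
    have : (8 ^ s <= 2 ^ (4 * s))%N by rewrite expnM leq_exp2r.
    move=> h8; have h9 := leq_mul h8 (leqnn ((K - 1) ^ W)%N).
    have h10 := leq_trans h9 hd.
    have := leq_mul (leqnn (2 * b * B * b ^ Mm)%N) h10.
    rewrite expnS; move: (8 ^ s)%N ((K - 1) ^ W)%N (K ^ W)%N (b ^ Mm)%N => u v w z.
    by rewrite -/B; lia.
  have := leq_mul (leqnn (K ^ W)%N) hs.
  move: (8 ^ s)%N (b ^ J)%N (K ^ W)%N (b ^ Mm)%N => u v w z.
  by lia.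
apply: (@le_trans _ _ (q * K ^ W * ((2 * b * B + 4) * b ^ Mm))%N%:R).
  by rewrite -natrX -natrM ler_nat.
rewrite 3!natrM [(b ^ Mm)%:R]natrX -/T natrD 2!natrM /local_const.
have p1 : 0 <= 4 * b%:R ^+ 2 * T * (q%:R * (K ^ W)%:R).
  by rewrite !mulr_ge0 ?exprn_ge0 ?ler0n // ltW.
rewrite -subr_ge0; apply: le_trans p1 _; rewrite le_eqVlt; apply/orP; left; apply/eqP.
by ring.
Qed.

Lemma local_const_ge : 4 * b%:R ^+ 2 <= local_const.
Proof.
by rewrite /local_const lerDr addr_ge0 ?mulr_ge0 ?ler0n.
Qed.

(** Here [d^k >= (8^s)^2], so the count, of order [d^(-k/2)], and the expected value are both small
    separately. *)
Lemma dvd_count_large d : (0 < d)%N -> coprime d b' -> (2 ^ (12 * s) < d ^ k)%N ->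
  `|dvd_count d - total_count * d%:R ^- k| <= local_const * T / 8 ^+ s.
Proof.
move=> d0; rewrite b'E coprimeMr coprime_sym => /andP[copb copB] large.
set U := 2 * b%:R ^+ 2 * T; have U0 : 0 < U by rewrite !mulr_gt0 ?exprn_gt0 ?ltr0n.
have h8 : 0 < 8 ^+ s :> R by rewrite exprn_gt0.
have large' : (8 ^+ s) ^+ 2 <= d%:R ^+ k :> R.
  rewrite -!natrX ler_nat; apply: leq_trans (ltnW large).
  by rewrite -[8%N]/(2 ^ 3)%N -!expnM leq_pexp2l //; lia.
have dk : 0 < d%:R ^+ k :> R by rewrite exprn_gt0 ?ltr0n.
have F_le : dvd_count d <= U / 8 ^+ s.
  rewrite ler_pdivlMr // -(@ler_pXn2r _ 2) ?nnegrE ?(ltW U0) ?mulr_ge0 ?ler0n ?(ltW h8) //.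
  rewrite exprMn; apply: (le_trans _ (dvd_count_le d0 copb)).
  by rewrite ler_wpM2l ?sqr_ge0.
have P_le : total_count * d%:R ^- k <= U / 8 ^+ s.
  apply: ler_pM; rewrite ?ler0n ?invr_ge0 ?(ltW dk) ?total_count_le //.
  rewrite lef_pV2 ?posrE //; apply: le_trans large'.
  by rewrite expr2 ler_peMl ?(ltW h8) // exprn_ege1 // ler1n.
have F0 : 0 <= dvd_count d by rewrite ler0n.
have P0 : 0 <= total_count * d%:R ^- k by rewrite mulr_ge0 ?ler0n ?invr_ge0 ?(ltW dk).
have C_le : U / 8 ^+ s <= local_const * T / 8 ^+ s.
  have c1 : 2 * b%:R ^+ 2 <= local_const.
    by apply: (le_trans _ local_const_ge); rewrite ler_wpM2r ?exprn_ge0 ?ler0n // ler_nat.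
  by rewrite ler_pM2r ?invr_gt0 //; exact: (ler_wpM2r (ltW T_gt0) c1).
rewrite ler_norml; apply/andP; split; lra.
Qed.

Lemma dvd_count_estimate d : (0 < d)%N -> coprime d b' ->
  `|dvd_count d - total_count * d%:R ^- k| <= local_const * T / 8 ^+ s.
Proof.
move=> d0 cop; case: (leqP (d ^ k) (2 ^ (12 * s))) => cmp.
  exact: dvd_count_small.
exact: dvd_count_large.
Qed.

(** With [u], [v] the two roots, [(v - u) (v + u) = 1] turns the right side into
    [2 / (u v (u + v))]. This telescopes the series of [d^(-3/2)]. *)
Lemma inv_pow32_le n : (0 < n)%N ->
  (n.+1%:R * Num.sqrt n.+1%:R)^-1 <= 2 / Num.sqrt n%:R - 2 / Num.sqrt n.+1%:R :> R.
Proof.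
move=> n0; set u := Num.sqrt n%:R; set v := Num.sqrt n.+1%:R.
have u0 : 0 < u by rewrite sqrtr_gt0 ltr0n.
have v0 : 0 < v by rewrite sqrtr_gt0 ltr0n.
have u2 : u ^+ 2 = n%:R by rewrite sqr_sqrtr ?ler0n.
have v2 : v ^+ 2 = n.+1%:R by rewrite sqr_sqrtr ?ler0n.
have uv : u <= v by rewrite ler_wsqrtr // ler_nat.
have d1 : (v - u) * (v + u) = 1 by rewrite -subr_sqr u2 v2 -natr1; ring.
have -> : 2 / u - 2 / v = 2 / (u * v * (v + u)).
  have e : 2 / (u * v * (v + u)) = 2 * ((v - u) * (v + u)) / (u * v * (v + u)) by rewrite d1 mulr1.
  have vu : v + u != 0 by rewrite gt_eqF // addr_gt0.
  by rewrite e; field; rewrite vu !gt_eqF.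
rewrite -v2.
have p1 : 0 < u * v by rewrite mulr_gt0.
have p2 : 0 < v + u by rewrite addr_gt0.
have p3 : 0 < v ^+ 2 * v by rewrite mulr_gt0 ?exprn_gt0.
rewrite ler_pdivlMr; last exact: mulr_gt0.
rewrite mulrC ler_pdivrMr //.
have -> : 2 * (v ^+ 2 * v) = v * v * (v + v) by ring.
apply: ler_pM; rewrite ?(ltW p1) ?(ltW p2) //; last by rewrite lerD2l.
exact: (ler_wpM2r (ltW v0) uv).
Qed.

Lemma sum_inv_pow32_le Y N : (0 < Y)%N -> (Y <= N)%N ->
  \sum_(d < N.+1 | (Y < d)%N) (d%:R * Num.sqrt d%:R)^-1 <= 2 / Num.sqrt Y%:R - 2 / Num.sqrt N%:R :> R.
Proof.
move=> Y0 /subnK <-; elim: (N - Y)%N => [|n IH].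
  by rewrite add0n subrr big1 // => i; rewrite ltnNge -ltnS ltn_ord.
rewrite addSn big_mkcond big_ord_recr /= -big_mkcond /= ltnS leq_addl.
have := @inv_pow32_le (n + Y)%N ltac:(lia).
move: IH; move: (\sum_(_ < _ | _) _) (2 / Num.sqrt Y%:R) => S A.
move: (2 / Num.sqrt (n + Y)%:R) (2 / Num.sqrt (n + Y).+1%:R) => u v.
by move: (_^-1) => w; lra.
Qed.

Lemma dvd_count_le_pow32 d : (0 < d)%N -> coprime d b' ->
  dvd_count d <= 2 * b%:R ^+ 2 * T * (d%:R * Num.sqrt d%:R)^-1.
Proof.
move=> d0; rewrite b'E coprimeMr coprime_sym => /andP[copb _].
have dp : 1 <= d%:R :> R by rewrite ler1n.
have sp : 0 < Num.sqrt d%:R :> R by rewrite sqrtr_gt0 ltr0n.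
rewrite ler_pdivlMr ?mulr_gt0 ?ltr0n //.
rewrite -(@ler_pXn2r _ 2) ?nnegrE ?mulr_ge0 ?ler0n ?exprn_ge0 ?ler0n ?(ltW sp) ?(ltW T_gt0) //.
apply: (le_trans _ (dvd_count_le d0 copb)).
rewrite exprMn ler_wpM2l ?sqr_ge0 // exprMn sqr_sqrtr ?ler0n // -exprSr.
by rewrite ler_weXn2l.
Qed.

Lemma dvd_count_not_coprime d : ~~ coprime d b' -> dvd_count d = 0.
Proof.
move=> ncop; rewrite /dvd_count big1 // => n /and3P[_ cop _].
apply/eqP; rewrite eqb0; apply: contra ncop => dvd.
have copk := coprime_dvdl dvd cop; rewrite -/b' in copk.
by move: copk; rewrite coprime_pexpl //; lia.
Qed.

Definition free_count : R := (\sum_(n < X.+1 | pstar b n) `[< power_free k n >])%N%:R.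

Lemma free_count_moebius :
  free_count = \sum_(d < X.+1 | (0 < d)%N && coprime d b') moebius R d * dvd_count d.
Proof.
have k0 : (0 < k)%N by lia.
rewrite /free_count natr_sum.
transitivity (\sum_(n < X.+1 | pstar b n) \sum_(d < X.+1 | (0 < d)%N && (d ^ k %| n)%N) moebius R d).
  apply: eq_bigr => n /and3P[n0 _ _].
  have bd : (0 < n <= X)%N by rewrite n0 -ltnS ltn_ord.
  case: asboolP => h; first by rewrite (sum_moebius_power_free R k0 bd h).
  by rewrite (sum_moebius_not_power_free R k0 bd h).
rewrite (exchange_big_dep (fun d : 'I_X.+1 => (0 < d)%N)) /=; last by move=> n d _ /andP[].
rewrite (bigID (fun d : 'I_X.+1 => coprime d b')) /= [X in _ + X]big1 ?addr0; last first.
  move=> d /andP[d0 ncop]; rewrite sumr_const -mulr_natr.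
  suff -> : (#|[pred n : 'I_X.+1 | pstar b n && ((0 < d)%N && (d ^ k %| n)%N)]|)%:R = dvd_count d.
    by rewrite dvd_count_not_coprime // mulr0.
  rewrite -sum1_card /dvd_count -big_mkcondr; congr _%:R.
  by apply: eq_bigl => n; rewrite inE d0.
apply: eq_bigr => d /andP[d0 _].
rewrite sumr_const -mulr_natr -sum1_card /dvd_count -big_mkcondr; congr (_ * _%:R).
by apply: eq_bigl => n; rewrite unfold_in /= d0.
Qed.

(** The added [12 b^2] is [4 b^2] for the moduli with [d > 4^s] and [8 b^2] for truncating the
    Moebius series. *)
Definition global_const : R := local_const + 12 * b%:R ^+ 2.

Lemma free_count_estimate :
  `|free_count - total_count / zeta_restr R k (coprime^~ b')| <= global_const * T / 2 ^+ s.
Proof.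
set Z := zeta_restr R k _.
have k2 : (2 <= k)%N by lia.
have /andP[Z1 Z2] := @zeta_restr_bounds R k (coprime^~ b') k2 (coprime1n _).
rewrite -/Z in Z1 Z2.
(* The cut balances the errors: [4^s] terms of size [8^-s] below it, and a tail of order
   [Y^(-1/2) = 2^-s] above it. *)
set Y := (4 ^ s)%N; have Y0 : (0 < Y)%N by rewrite expn_gt0.
have YX : (Y <= X)%N.
  case/andP: X_bounds => lX _; apply: leq_trans lX; rewrite -mul2n expnM.
  have [_ h] := scale_bounds.
  apply: (@leq_trans (4 ^ Mm)%N); first by rewrite leq_pexp2l //; lia.
  by case: (Mm) => // n; rewrite leq_exp2r // -[4%N]/(2 ^ 2)%N leq_sqr.
set S := \sum_(d < Y.+1 | (0 < d)%N && coprime d b') moebius R d * d%:R ^- k.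
have S_est : `|S - Z^-1| <= 4 / 2 ^+ s.
  have h := @moebius_truncated R k b' Y k_ge3 Y0; rewrite -/Z -/S in h.
  have -> : S - Z^-1 = (Z * S - 1) / Z by field; rewrite gt_eqF //; lra.
  rewrite normrM -[X in _ <= X]mulr1; apply: ler_pM => //.
    apply: le_trans h _; rewrite ler_pM2l // lef_pV2 ?posrE ?exprn_gt0 ?ltr0n //.
    by rewrite -natrX ler_nat leq_exp2r.
  rewrite ger0_norm ?invr_ge0; last by lra.
  by rewrite invf_le1 //; lra.
have h2 : 0 < 2 ^+ s :> R by rewrite exprn_gt0.
have small : `|\sum_(d < Y.+1 | (0 < d)%N && coprime d b') moebius R d * dvd_count d
    - total_count * S| <= local_const * T / 2 ^+ s.
  rewrite /S big_distrr /= -sumrB; apply: le_trans (ler_norm_sum _ _ _) _.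
  apply: (@le_trans _ _ (\sum_(d < Y.+1 | (0 < d)%N) local_const * T / 8 ^+ s)).
    rewrite [X in X <= _]big_mkcondr /=; apply: ler_sum => d d0.
    have c0 : 0 <= local_const * T / 8 ^+ s.
      rewrite !mulr_ge0 ?invr_ge0 ?exprn_ge0 ?(ltW T_gt0) ?ler0n //.
      by apply: le_trans local_const_ge; rewrite mulr_ge0 ?exprn_ge0.
    case: ifP => // cop.
    rewrite mulrCA -mulrBr normrM -[X in _ <= X]mul1r.
    by apply: ler_pM => //; [exact: norm_moebius_le1 | exact: dvd_count_estimate].
  rewrite big_mkcond big_ord_recl /= add0r sumr_const card_ord -[_ *+ Y]mulr_natr natrX.
  rewrite le_eqVlt; apply/orP; left; apply/eqP.
  have -> : 8 ^+ s = 4 ^+ s * 2 ^+ s :> R by rewrite -exprMn; congr (_ ^+ s); ring.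
  by field; rewrite !expf_neq0 // pnatr_eq0.
have large : `|\sum_(d < X.+1 | ((0 < d)%N && coprime d b') && (Y < d)%N) moebius R d * dvd_count d|
    <= 4 * b%:R ^+ 2 * T / 2 ^+ s.
  apply: le_trans (ler_norm_sum _ _ _) _.
  apply: (@le_trans _ _ (\sum_(d < X.+1 | (Y < d)%N) 2 * b%:R ^+ 2 * T * (d%:R * Num.sqrt d%:R)^-1)).
    rewrite [X in X <= _]big_mkcond [X in _ <= X]big_mkcond /=; apply: ler_sum => d _.
    case: (ltnP Y d) => Yd; rewrite ?andbT ?andbF //.
    have d0 : (0 < d)%N by apply: leq_ltn_trans Yd.
    rewrite d0 /=; case: ifP => cop; last first.
      by rewrite !mulr_ge0 ?exprn_ge0 ?invr_ge0 ?mulr_ge0 ?sqrtr_ge0 ?ler0n ?(ltW T_gt0).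
    rewrite normrM -[X in _ <= X]mul1r.
    apply: ler_pM => //; first exact: norm_moebius_le1.
    by rewrite ger0_norm ?ler0n // dvd_count_le_pow32.
  rewrite -big_distrr /=.
  apply: (@le_trans _ _ (2 * b%:R ^+ 2 * T * (2 / 2 ^+ s))); last by rewrite le_eqVlt; apply/orP; left; apply/eqP; field; rewrite gt_eqF.
  apply: ler_wpM2l; first by rewrite !mulr_ge0 ?exprn_ge0 ?ler0n ?(ltW T_gt0).
  apply: le_trans (sum_inv_pow32_le Y0 YX) _.
  have -> : Num.sqrt Y%:R = 2 ^+ s :> R.
    rewrite /Y natrX; have -> : 4%:R = 2 ^+ 2 :> R by ring.
    by rewrite -exprM mulnC exprM sqrtr_sqr ger0_norm // exprn_ge0.
  by rewrite gerBl divr_ge0 ?sqrtr_ge0 ?ler0n.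
have eq_low : \sum_(d < X.+1 | ((0 < d)%N && coprime d b') && ~~ (Y < d)%N) moebius R d * dvd_count d =
    \sum_(d < Y.+1 | (0 < d)%N && coprime d b') moebius R d * dvd_count d.
  rewrite (big_ord_widen_cond X.+1 (fun d => (0 < d)%N && coprime d b')
    (fun d => moebius R d * dvd_count d)) ?ltnS //.
  by apply: eq_bigl => d; rewrite -leqNgt ltnS.
rewrite free_count_moebius (bigID (fun d : 'I_X.+1 => (Y < d)%N)) /= eq_low.
set low := \sum_(d < Y.+1 | _) _ in small *; set hi := \sum_(_ < _ | _) _ in large *.
have -> : hi + low - total_count / Z = hi + (low - total_count * S) + total_count * (S - Z^-1) by ring.
apply: le_trans (ler_normD _ _) _.
have e3 : `|total_count * (S - Z^-1)| <= 8 * b%:R ^+ 2 * T / 2 ^+ s.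
  rewrite normrM ger0_norm ?ler0n //.
  have -> : 8 * b%:R ^+ 2 * T / 2 ^+ s = (2 * b%:R ^+ 2 * T) * (4 / 2 ^+ s) by field; rewrite gt_eqF.
  by apply: ler_pM => //; exact: total_count_le.
have -> : global_const * T / 2 ^+ s = (4 * b%:R ^+ 2 * T / 2 ^+ s + local_const * T / 2 ^+ s) + 8 * b%:R ^+ 2 * T / 2 ^+ s.
  by rewrite /global_const; field; rewrite gt_eqF.
apply: lerD => //; apply: le_trans (ler_normD _ _) _; exact: lerD.
Qed.

End MainEstimate.

Local Close Scope ring_scope.

(** * Recursive functions *)

Lemma recursive_ext n (f g : n.-tuple nat -> nat) : f =1 g -> recursive f -> recursive g.
Proof. by move=> /funext ->. Qed.

Lemma recursive_comp1 n (op : nat -> nat) (f : n.-tuple nat -> nat) :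
  recursive (fun v : 1.-tuple nat => op (tnth v ord0)) -> recursive f ->
  recursive (fun v => op (f v)).
Proof.
move=> hop hf; apply: recursive_ext (rec_comp hop (fun=> hf)) => v /=.
by rewrite tnth_mktuple.
Qed.

Lemma recursive_comp2 n (op : nat -> nat -> nat) (f g : n.-tuple nat -> nat) :
  recursive (fun v : 2.-tuple nat => op (tnth v ord0) (tnth v ord_max)) ->
  recursive f -> recursive g -> recursive (fun v => op (f v) (g v)).
Proof.
move=> hop hf hg.
have h i : recursive (if i == ord0 :> 'I_2 then f else g) by case: ifP.
apply: recursive_ext (rec_comp hop h) => v /=.
by rewrite !tnth_mktuple.
Qed.

Lemma recursive_succ n (f : n.-tuple nat -> nat) :
  recursive f -> recursive (fun v => (f v).+1).
Proof.
by apply: (recursive_comp1 (op := S)); exact: recursive_ext rec_succ.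
Qed.

Lemma recursive_const n c : recursive (fun _ : n.-tuple nat => c).
Proof. by elim: c => [|c IH]; [exact: rec_zero | exact: recursive_succ]. Qed.

(** Primitive recursion on the first argument. The step receives the counter, the previous value and
    the parameter, and uses the last two. *)
Lemma recursive_prim2 (op : nat -> nat -> nat) (base : nat -> nat) (step : nat -> nat -> nat) :
  recursive (fun v : 1.-tuple nat => base (tnth v ord0)) ->
  recursive (fun v : 3.-tuple nat => step (tnth v (@Ordinal 3 1 isT)) (tnth v ord_max)) ->
  op 0 =1 base -> (forall x y, op x.+1 y = step (op x y) y) ->
  recursive (fun v : 2.-tuple nat => op (tnth v ord0) (tnth v ord_max)).
Proof.
move=> hbase hstep op0 opS; apply: recursive_ext (rec_prim hbase hstep) => v /=.
case/tupleP: v => x v; case/tupleP: v => y v.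
rewrite theadE [in RHS]tnth0 [tnth [tuple of x :: _] ord_max](tnth_nth 0) /=.
elim: x => [|x IH] /=; first by rewrite op0 (tnth_nth 0).
rewrite opS -IH; congr step; by rewrite (tnth_nth 0).
Qed.

Lemma recursive_add n (f g : n.-tuple nat -> nat) :
  recursive f -> recursive g -> recursive (fun v => f v + g v).
Proof.
apply: (recursive_comp2 (op := addn)).
exact: (recursive_prim2 (rec_proj (ord0 : 'I_1)) (step := fun r _ => r.+1)
  (recursive_succ (rec_proj _))).
Qed.

Lemma recursive_mul n (f g : n.-tuple nat -> nat) :
  recursive f -> recursive g -> recursive (fun v => f v * g v).
Proof.
apply: (recursive_comp2 (op := muln)).
exact: (recursive_prim2 (rec_zero 1) (step := fun r y => y + r)
  (recursive_add (rec_proj _) (rec_proj _))).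
Qed.

Lemma recursive_pred n (f : n.-tuple nat -> nat) :
  recursive f -> recursive (fun v => (f v).-1).
Proof.
apply: (recursive_comp1 (op := predn)).
apply: recursive_ext (rec_prim (rec_zero 0) (rec_proj (ord0 : 'I_2))) => v /=.
case/tupleP: v => x v; rewrite theadE tnth0.
by case: x => [|x] //=; rewrite (tnth_nth 0).
Qed.

Lemma recursive_sub n (f g : n.-tuple nat -> nat) :
  recursive f -> recursive g -> recursive (fun v => f v - g v).
Proof.
move=> hf hg; apply: (recursive_comp2 (op := fun y x => x - y) _ hg hf).
apply: (recursive_prim2 (op := fun y x => x - y) (rec_proj (ord0 : 'I_1))
  (step := fun r _ => r.-1) (recursive_pred (rec_proj _))) => [y|x y].
  by rewrite subn0.
by rewrite subnS.
Qed.

Lemma recursive_behead n (f : n.-tuple nat -> nat) :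
  recursive f -> recursive (fun v : n.+1.-tuple nat => f [tuple of behead v]).
Proof.
move=> hf; apply: recursive_ext (rec_comp hf (fun i => rec_proj (lift ord0 i))) => v /=.
congr f; apply: eq_from_tnth => i; rewrite tnth_mktuple tnth_behead.
by congr tnth; apply: val_inj; rewrite /= inordK ?ltnS.
Qed.

(** The quotient is the least [i] with [f v < (i + 1) g v], that is, the least zero of a truncated
    difference; [g v > 0] guarantees one. *)
Lemma recursive_div n (f g : n.-tuple nat -> nat) : recursive f -> recursive g ->
  (forall v, 0 < g v) -> recursive (fun v => f v %/ g v).
Proof.
move=> hf hg g0.
pose F (w : n.+1.-tuple nat) :=
  (f [tuple of behead w]).+1 - (tnth w ord0).+1 * g [tuple of behead w].
have beh (v : n.-tuple nat) (i : nat) : [tuple of behead [tuple of i :: v]] = v by apply: val_inj.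
apply: (@rec_mu n F).
- apply: recursive_sub; first by apply: recursive_succ; exact: recursive_behead.
  apply: recursive_mul; last exact: recursive_behead.
  by apply: recursive_succ; exact: rec_proj.
- by move=> v; rewrite /F tnth0 beh; apply/eqP; rewrite subn_eq0 ltn_ceil.
move=> v i lti; rewrite /F tnth0 beh; apply/eqP; rewrite subn_eq0 -ltnNge ltnS.
by rewrite -leq_divRL.
Qed.

Local Open Scope ring_scope.

Lemma effectively_computable_inv (R : realType) (D : nat -> nat) :
  recursive (fun v : 2.-tuple nat => D (tnth v ord0)) -> (forall b, 0 < D b)%N ->
  effectively_computable (fun b => (D b)%:R^-1 : R).
Proof.
(* The numerator is the floor of [(m + 1) / D b], which is within 1 of [(m + 1) / D b]. *)
move=> hD D0; exists (fun v : 2.-tuple nat => ((tnth v ord_max).+1 %/ D (tnth v ord0))%N).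
  apply: recursive_div => //; by apply: recursive_succ; exact: rec_proj.
move=> b m; rewrite !(tnth_nth 0%N) /=.
have Dp : 0 < (D b)%:R :> R by rewrite ltr0n.
have mp : 0 < m.+1%:R :> R by rewrite ltr0n.
have -> : (D b)%:R^-1 = (m.+1%:R / (D b)%:R) / m.+1%:R :> R.
  by rewrite mulrAC divff ?mul1r // gt_eqF.
rewrite -mulrBl normrM [X in _ * X]ger0_norm ?invr_ge0 ?ler0n //.
rewrite -[X in _ <= X]mul1r ler_pM2r ?invr_gt0 //.
have h1 : (m.+1 %/ D b)%:R <= m.+1%:R / (D b)%:R :> R.
  by rewrite ler_pdivlMr // -natrM ler_nat leq_divM.
have h2 : m.+1%:R / (D b)%:R <= (m.+1 %/ D b)%:R + 1 :> R.
  by rewrite ler_pdivrMr // natr1 -natrM ler_nat ltnW // ltn_ceil.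
rewrite ger0_norm ?subr_ge0 //.
by rewrite lerBlDl.
Qed.

Local Close Scope ring_scope.

(** * The asymptotic formula *)

Lemma card_fset_set_nat (A : set nat) (Q : pred nat) X :
  (forall n, A n <-> Q n /\ n <= X) ->
  #|` fset_set A| = \sum_(n < X.+1 | Q n) 1.
Proof.
move=> AE.
have finA : finite_set A.
  apply: (sub_finite_set (B := `I_X.+1)); last exact: finite_II.
  by move=> n /AE[_ le].
have -> : fset_set A = [fset n in [seq n <- iota 0 X.+1 | Q n]]%fset.
  apply/fsetP => n; rewrite in_fset_set //.
  have -> : (n \in [fset n in [seq n <- iota 0 X.+1 | Q n]]%fset) = Q n && (n <= X).
    by rewrite !inE mem_filter mem_iota add0n ltnS.
  apply/idP/idP; first by rewrite inE => /AE[-> ->].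
  by move=> /andP[q le]; rewrite inE; apply/AE.
rewrite card_fseq undup_id ?filter_uniq ?iota_uniq // size_filter -sum1_count.
by rewrite -(big_mkord Q (fun=> 1)) /index_iota subn0.
Qed.

Lemma exists_square_scale c M : 0 < c -> c ^ 2 <= M ->
  exists2 s, 0 < s & (c * s) ^ 2 <= M < (c * s.+1) ^ 2.
Proof.
move=> c0 leM.
have ex : exists s, (c * s) ^ 2 <= M by exists 1; rewrite muln1.
have bd s : (c * s) ^ 2 <= M -> s <= M.
  apply: leq_trans; apply: (@leq_trans (c * s)); first by rewrite leq_pmull.
  by rewrite expnS expn1; case: (c * s) => // n; rewrite leq_pmulr.
case: (ex_maxnP ex bd) => s hs maxs; exists s.
  by apply: (maxs 1); rewrite muln1.
by rewrite hs ltnNge; apply/negP => /maxs; rewrite ltnn.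
Qed.

Lemma sum_ord_le N m : \sum_(n < m) (n <= N) <= N.+1.
Proof.
suff : \sum_(n < m) (n <= N) <= minn m N.+1 by rewrite leq_min => /andP[].
elim: m => [|m IH]; first by rewrite big_ord0.
rewrite big_ord_recr /=; move: IH; move: (\sum_(_ < _) _) => S.
by case: (leqP m N) => h /=; lia.
Qed.

Local Open Scope classical_set_scope.
Local Open Scope ring_scope.

Section Final.
Variable R : realType.

(* At least [4 * b * scale_const b], and positive even at [b = 0]. *)
Definition decay_denominator (b : nat) := (256 * b.+1 ^ 4)%N.

Lemma decay_denominator_computable :
  effectively_computable (fun b => (decay_denominator b)%:R^-1 : R).
Proof.
apply: effectively_computable_inv; last by move=> b; rewrite muln_gt0 expn_gt0.
have rs : recursive (fun v : 2.-tuple nat => (tnth v ord0).+1).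
  by apply: recursive_succ; exact: rec_proj.
apply: recursive_mul; first exact: recursive_const.
apply: (@recursive_ext _ (fun v : 2.-tuple nat =>
  (tnth v ord0).+1 * ((tnth v ord0).+1 * ((tnth v ord0).+1 * (tnth v ord0).+1)))%N).
  by move=> v; rewrite !expnS expn0 muln1.
by do 3! [apply: recursive_mul => //].
Qed.

Variable b : nat.
Hypothesis b_gt1 : (1 < b)%N.
Let b' := (b ^ 3 - b)%N.
Let b_gt0 : (0 < b)%N. Proof. exact: ltnW. Qed.
Let b'_gt0 : (0 < b')%N.
Proof. by rewrite /b' subn_gt0 -{1}[b]expn1 ltn_exp2l. Qed.

Definition inv_density := (b ^ (b.*2 + 4))%N.

Lemma scale_const_gt0 : (0 < scale_const b)%N.
Proof. by rewrite /scale_const 2!muln_gt0 expn_gt0 b_gt0. Qed.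

Lemma scale_sqr_ge : (b.*2 + 4 <= scale_const b ^ 2)%N.
Proof. by rewrite /scale_const; move: b_gt1; clear; nia. Qed.

Lemma global_const_ge0 : 0 <= global_const R b.
Proof. by rewrite /global_const /local_const !addr_ge0 ?mulr_ge0 ?exprn_ge0. Qed.

Section Scale.
Variables (X Mm k s : nat).
Hypothesis X_bounds : (b ^ Mm.*2 <= X < b ^ Mm.+1.*2)%N.
Hypothesis k_ge3 : (3 <= k)%N.
Hypothesis s_gt0 : (0 < s)%N.
Hypothesis sM : ((scale_const b * s) ^ 2 <= Mm)%N.
Let T : R := b%:R ^+ Mm.
Let Z := zeta_restr R k (coprime^~ b').

Lemma main_term_ge : T / (2 * inv_density%:R) <= total_count R b X / Z.
Proof.
have k2 : (2 <= k)%N by lia.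
have /andP[Z1 Z2] := @zeta_restr_bounds R k (coprime^~ b') k2 (coprime1n _).
rewrite -/Z in Z1 Z2; have Zp : 0 < Z by lra.
have leM : (b.*2 + 4 <= Mm)%N.
  apply: leq_trans scale_sqr_ge _; apply: leq_trans sM.
  by rewrite leq_sqr leq_pmulr.
have h := pstar_count_ge b_gt1 X_bounds leM.
have densp : 0 < inv_density%:R :> R by rewrite ltr0n expn_gt0 b_gt0.
have h' : T / inv_density%:R <= total_count R b X.
  by rewrite ler_pdivrMr // /total_count -natrM /T -natrX ler_nat.
have -> : T / (2 * inv_density%:R) = T / inv_density%:R / 2 by field; rewrite gt_eqF.
apply: ler_pM => //; first by rewrite divr_ge0 ?exprn_ge0 ?ler0n.
by rewrite lef_pV2 ?posrE.
Qed.

(** The absolute error is of order [T / 2^s] and the main term is at least of order [T], by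
    [main_term_ge]. *)
Lemma relative_error : exists2 E : R, `|E| <= global_const R b * (2 * inv_density%:R) / 2 ^+ s &
  free_count R b X k = total_count R b X / Z * (1 + E).
Proof.
have densp : 0 < inv_density%:R :> R by rewrite ltr0n expn_gt0 b_gt0.
have Tp : 0 < T by rewrite exprn_gt0 ?ltr0n.
have ge := main_term_ge; have est := free_count_estimate R b_gt1 X_bounds k_ge3 s_gt0 sM.
rewrite -/b' -/Z -/T in est.
have tp : 0 < T / (2 * inv_density%:R) by rewrite divr_gt0 ?mulr_gt0.
set M0 := _ / Z in ge est *; have M0p : 0 < M0 := lt_le_trans tp ge.
exists ((free_count R b X k - M0) / M0); last by field; rewrite gt_eqF.
rewrite normrM normfV (gtr0_norm M0p) ler_pdivrMr //; apply: le_trans est _.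
have -> : global_const R b * T / 2 ^+ s =
  global_const R b * (2 * inv_density%:R) / 2 ^+ s * (T / (2 * inv_density%:R)).
  by field; rewrite gt_eqF ?expf_neq0.
apply: ler_wpM2l => //.
by rewrite divr_ge0 ?mulr_ge0 ?exprn_ge0 ?global_const_ge0 ?ler0n.
Qed.

End Scale.

(** Since [Mm] is at most of order [s^2], [sqrt (ln x)] is [O(s)], and the denominator brings the
    exponent down to [(s + 1) / 2]. Then [exp (-1/2) >= 1/2] applies; the factor 2 absorbs [s + 1]
    in place of [s]. *)
Lemma half_pow_le (x : R) Mm s : 0 < x -> x < (b ^ Mm.+1.*2)%:R ->
  (Mm < (scale_const b * s.+1) ^ 2)%N ->
  (2 ^+ s)^-1 <= 2 * expR (- ((decay_denominator b)%:R^-1 * Num.sqrt (ln x))).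
Proof.
move=> x0 ltx ltM.
have bp : 0 < b%:R :> R by rewrite ltr0n.
set D0 := scale_const b in ltM.
have lnb : ln (b%:R : R) <= b%:R.
  have -> : b%:R = expR (ln b%:R) :> R by rewrite lnK.
  rewrite [X in ln X]lnK //; apply: le_trans (expR_ge1Dx _).
  by rewrite lerDr.
have ln_le : ln x <= (2 * b * D0 * s.+1)%N%:R ^+ 2.
  apply: (@le_trans _ _ (ln ((b ^ Mm.+1.*2)%:R : R))).
    by rewrite ler_ln ?posrE ?ltr0n ?expn_gt0 ?b_gt0 // ltW.
  rewrite natrX lnXn // -[ln _ *+ _]mulr_natl.
  apply: (@le_trans _ _ (Mm.+1.*2%:R * b%:R)); first by rewrite ler_wpM2l.
  rewrite -natrM -natrX ler_nat -mul2n.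
  apply: (@leq_trans (2 * (D0 * s.+1) ^ 2 * b)); first by rewrite leq_mul2r leq_mul2l ltM !orbT.
  move: (D0 * s.+1)%N (mulnA (2 * b) D0 s.+1) => z <-.
  by rewrite !expnS expn0; move: b_gt0; clear; nia.
have sqrt_le : Num.sqrt (ln x) <= (2 * b * D0 * s.+1)%N%:R.
  apply: le_trans (ler_wsqrtr ln_le) _.
  by rewrite sqrtr_sqr ger0_norm.
have Dp : 0 < (decay_denominator b)%:R :> R by rewrite ltr0n muln_gt0 expn_gt0.
have exp_le : (decay_denominator b)%:R^-1 * Num.sqrt (ln x) <= s.+1%:R * 2^-1.
  rewrite mulrC ler_pdivrMr //; apply: le_trans sqrt_le _.
  rewrite mulrAC ler_pdivlMr // -!natrM ler_nat [(_ * s.+1 * 2)%N]mulnAC.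
  rewrite [(s.+1 * _)%N]mulnC leq_mul2r; apply/orP; right.
  rewrite /D0 /scale_const /decay_denominator.
  have -> : (2 * b * (60 * b ^ 2 * b.+1) * 2 = (240 * b ^ 3) * b.+1)%N by ring.
  rewrite [(b.+1 ^ 4)%N]expnSr mulnA leq_mul2r; apply/orP; right.
  by rewrite leq_mul // leq_exp2r.
apply: (@le_trans _ _ (2 * expR (s.+1%:R * - 2^-1))); last first.
  by rewrite ler_pM2l // ler_expR mulrN lerN2.
rewrite expRM_natl.
have half : 2^-1 <= expR (- 2^-1 : R).
  by apply: le_trans (expR_ge1Dx _); lra.
apply: (@le_trans _ _ (2 * 2^-1 ^+ s.+1)).
  by rewrite exprS mulrA divff ?mul1r ?exprVn // pnatr_eq0.
by rewrite ler_pM2l // lerXn2r ?nnegrE ?expR_ge0 // invr_ge0.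
Qed.

Lemma Pstar_cardE (x : R) : 0 <= x -> (Pstar_card b x)%:R = total_count R b (Num.truncn x).
Proof.
move=> x0; rewrite /Pstar_card /total_count (@card_fset_set_nat _ (pstar b) (Num.truncn x)) // => n.
rewrite /Pstar /pstar /= truncn_ge_nat //; split.
  by case=> n0 nx cop e; rewrite n0 cop -e eqxx.
by case=> /and3P[n0 cop /eqP e] nx; split.
Qed.

Lemma p_countE k (x : R) : 0 <= x -> (p_count k b x)%:R = free_count R b (Num.truncn x) k.
Proof.
move=> x0; rewrite /p_count /free_count -big_mkcondr /=.
rewrite (@card_fset_set_nat _ (fun n => pstar b n && `[< power_free k n >]) (Num.truncn x)) // => n.
rewrite /Pstar /pstar /= truncn_ge_nat //; split.
  by case=> -[n0 nx cop e] pf; rewrite n0 cop -e eqxx; split => //; apply/asboolP.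
by case=> /andP[/and3P[n0 cop /eqP e] /asboolP pf] nx; split.
Qed.

(** With all such palindromes at most [N], every [free_count] would be at most [N + 1]; for large
    [X] the main term minus the error exceeds this. *)
Lemma infinite_cube_free : infinite_set [set n : nat | palindrome b n /\ power_free 3 n].
Proof.
move=> fin; set A := [set _ | _] in fin.
pose N := \max_(n <- fset_set A) n.
have leN n : A n -> (n <= N)%N.
  by move=> An; apply: leq_bigmax_seq => //; rewrite in_fset_set // inE.
have gc0 := global_const_ge0.
set g : R := 4 * inv_density%:R * global_const R b.
(* The first summand makes the error at most half the lower bound for the main term, through
   [g <= s <= 2^s]; the second makes the remaining half at least [N + 2], through [s <= T]. *)
pose s := ((Num.truncn g).+1 + 4 * inv_density * N.+2)%N.
pose Mm := ((scale_const b * s) ^ 2)%N; pose X := (b ^ Mm.*2)%N.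
have X_bounds : (b ^ Mm.*2 <= X < b ^ Mm.+1.*2)%N by rewrite /X leqnn ltn_exp2l // ltn_double ltnSn.
have s0 : (0 < s)%N by [].
have est := free_count_estimate R b_gt1 X_bounds (leqnn 3) s0 (leqnn _).
have ge := main_term_ge X_bounds (leqnn 3) s0 (leqnn _).
have densp : 0 < inv_density%:R :> R by rewrite ltr0n expn_gt0 b_gt0.
set T : R := b%:R ^+ Mm in est ge.
have Tp : 0 < T by rewrite exprn_gt0 ?ltr0n.
have count_le : free_count R b X 3 <= N.+1%:R.
  rewrite /free_count ler_nat; apply: leq_trans (sum_ord_le N X.+1).
  rewrite big_mkcond; apply: leq_sum => n _; case: ifP => // /and3P[n0 cop /eqP e].
  case: asboolP => // pf; rewrite leN //; split => //; split => //.
  apply/negP => dvd; have : (b %| gcdn n (b ^ 3 - b))%N.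
    by rewrite dvdn_gcd dvd dvdn_sub // expnS dvdn_mulr.
  by rewrite (eqP cop) dvdn1; move: b_gt1; case: (b) => [|[]].
have pow_s : s%:R <= 2 ^+ s :> R by rewrite -natrX ler_nat ltnW // ltn_expl.
have g_s : g <= 2 ^+ s.
  apply: le_trans pow_s; apply: ltW; apply: lt_le_trans (truncnS_gt g) _.
  by rewrite ler_nat leq_addr.
have h2 : 0 < 2 ^+ s :> R by rewrite exprn_gt0.
have err_le : global_const R b * T / 2 ^+ s <= T / (4 * inv_density%:R).
  rewrite ler_pdivrMr // mulrAC ler_pdivlMr ?mulr_gt0 //.
  have -> : global_const R b * T * (4 * inv_density%:R) = T * g by rewrite /g; ring.
  by rewrite ler_pM2l.
have T_ge : N.+2%:R <= T / (4 * inv_density%:R).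
  rewrite ler_pdivlMr ?mulr_gt0 //; apply: (@le_trans _ _ s%:R).
    by rewrite -!natrM ler_nat mulnC leq_addl.
  rewrite /T -natrX ler_nat; apply: (@leq_trans Mm); last by rewrite ltnW // ltn_expl.
  rewrite /Mm; apply: (@leq_trans (scale_const b * s)).
    by rewrite leq_pmull // scale_const_gt0.
  by rewrite expnS expn1; case: (_ * _)%N => // n; rewrite leq_pmulr.
have split2 : T / (2 * inv_density%:R) = T / (4 * inv_density%:R) + T / (4 * inv_density%:R).
  by field; rewrite gt_eqF.
rewrite split2 in ge; have := le_trans est err_le; rewrite ler_norml => /andP[lo _].
have NN : N.+1%:R < N.+2%:R :> R by rewrite ltr_nat.
set M0 := _ / zeta_restr _ _ _ in ge lo.
have := le_lt_trans count_le NN; apply/negP; rewrite -leNgt.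
apply: le_trans T_ge _.
by move: lo ge; move: (T / _) (free_count _ _ _ _) (M0) => t f m lo ge; lra.
Qed.

Lemma count_asymptotics : exists C x0 : R, forall (k : nat) (x : R), (3 <= k)%N -> x0 <= x ->
  exists2 E : R, `|E| <= C * expR (- ((decay_denominator b)%:R^-1 * Num.sqrt (ln x))) &
    (p_count k b x)%:R = (Pstar_card b x)%:R / zeta (k%:R : R)
      * (\prod_(p <- primes (b ^ 3 - b)) (1 - (p%:R : R) ^- k)^-1) * (1 + E).
Proof.
(* The threshold ensures [scale_const b ^ 2 <= Mm], so that a positive [s] exists. Both constants
   are uniform in [k]. *)
exists (global_const R b * (2 * inv_density%:R) * 2), (b ^ (scale_const b ^ 2).*2)%:R => k x k3 x0x.
have x_gt0 : 0 < x by apply: lt_le_trans x0x; rewrite ltr0n expn_gt0 b_gt0.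
have x_ge0 := ltW x_gt0.
set X := Num.truncn x.
have leX : (b ^ (scale_const b ^ 2).*2 <= X)%N by rewrite truncn_ge_nat.
have X0 : (0 < X)%N by apply: leq_trans leX; rewrite expn_gt0 b_gt0.
pose Mm := (trunc_log b X)./2.
have X_bounds : (b ^ Mm.*2 <= X < b ^ Mm.+1.*2)%N.
  have /andP[l1 l2] := trunc_log_bounds b_gt1 X0.
  have [e1 e2] : (Mm.*2 <= trunc_log b X)%N /\ (trunc_log b X <= Mm.*2.+1)%N.
    by rewrite /Mm; have := odd_double_half (trunc_log b X); case: odd; split; lia.
  apply/andP; split; first by apply: leq_trans l1; rewrite leq_exp2l.
  by apply: leq_trans l2 _; rewrite leq_exp2l // doubleS ltnS.
have leM : (scale_const b ^ 2 <= Mm)%N.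
  rewrite -ltnS -ltn_double -(ltn_exp2l _ _ b_gt1); apply: leq_ltn_trans leX _.
  by case/andP: X_bounds.
have [s s0 /andP[s1 s2]] := exists_square_scale scale_const_gt0 leM.
have [E Ele EE] := relative_error X_bounds k3 s0 s1.
exists E.
  apply: le_trans Ele _; rewrite -[X in _ <= X]mulrA; apply: ler_wpM2l.
    by rewrite mulr_ge0 ?global_const_ge0 ?mulr_ge0.
  apply: half_pow_le s2 => //; apply: lt_le_trans (truncnS_gt x) _.
  by rewrite ler_nat; case/andP: X_bounds.
have k2 : (2 <= k)%N by lia.
rewrite p_countE // Pstar_cardE // -/X EE zeta_restr_coprime //.
by rewrite invfM -prodfV !mulrA.
Qed.

End Final.

Unset Implicit Arguments.

Theorem theorem1p2 (R : realType) :
  (forall b : nat, (2 <= b)%N ->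
     infinite_set [set n : nat | palindrome b n /\ power_free 3 n]) /\
  (exists2 c2 : nat -> R, effectively_computable c2 &
     forall b : nat, (2 <= b)%N ->
       0 < c2 b /\
       exists C x0 : R,
         forall (k : nat) (x : R), (3 <= k)%N -> x0 <= x ->
           exists2 E : R, `|E| <= C * expR (- (c2 b * Num.sqrt (ln x))) &
             (p_count k b x)%:R =
               (Pstar_card b x)%:R / zeta (k%:R : R)
               * (\prod_(p <- primes (b ^ 3 - b)) (1 - (p%:R : R) ^- k)^-1)
               * (1 + E)).
Proof.
split=> [b|]; first exact: infinite_cube_free.
exists (fun b => (decay_denominator b)%:R^-1); first exact: decay_denominator_computable.
move=> b b2; split; last exact: count_asymptotics.
by rewrite invr_gt0 ltr0n muln_gt0 expn_gt0.
Qed.
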